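(* Let $W\subset GL(V)$, $V=\mathbb{C}^n$, be a complex reflection group, let $m$ be the least common multiple of the orders of the elements of $W$, and let $\sigma\in \mathrm{Gal}(\mathbb{Q}[e^{2\pi i/m}]/\mathbb{Q})$. Then the $\sigma$-bimahonian distribution $W^\sigma(t,q)$ is the $\mathbb{N}^2$-graded Hilbert series (in the variables $t,q$) of the ring $$\mathbb{C}[V\oplus V]^{\Delta^\sigma W}\big/\left(\mathbb{C}[V\oplus V]^{W\times W^\sigma}_+\right).$$
   Context: A complex reflection group is a finite subgroup $W$ of $GL(V)$, $V=\mathbb{C}^n$, generated by reflections (elements whose fixed subspace has codimension $1$). Coordinates on $V$ are chosen so that the matrix entries of the elements of $W$ lie in $\mathbb{Q}[e^{2\pi i/m}]$, with $m$ the least common multiple of the orders of elements of $W$; all irreducible complex representations of $W$ can also be realized over this field. $W$ acts on $\mathbb{C}[V]=S(V^* )\cong\mathbb{C}[x_1,\dots,x_n]$ by the action induced from that on $V$; the coinvariant algebra is $A=\mathbb{C}[V]/(\mathbb{C}[V]^W_+)$, the quotient by the ideal generated by the invariants of positive degree, with graded pieces $A_i$. For an irreducible complex representation $\lambda$ of $W$ with character $\chi^\lambda$, the fake degree polynomial is $f^\lambda(q)=\sum_{i\ge0} q^i\langle\chi^\lambda, A_i\rangle_W$, where $\langle\cdot,\cdot\rangle_W$ is the inner product (intertwining number) of characters. For a Galois automorphism $\sigma$, $\sigma(\lambda)$ is the irreducible representation obtained by applying $\sigma$ to the matrix entries of $\lambda$, so $\chi^{\sigma(\lambda)}(w)=\sigma(\chi^\lambda(w))$;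 $\overline{\lambda}$ is the complex conjugate (contragredient) representation. The $\sigma$-bimahonian distribution is $W^\sigma(t,q)=\sum_\lambda f^{\sigma(\lambda)}(t)\,f^{\overline{\lambda}}(q)$, summed over all irreducible complex representations $\lambda$ of $W$. Let $\sigma(w)$ be the matrix obtained by applying $\sigma$ to the entries of $w$, $W^\sigma=\{\sigma(w):w\in W\}\subset GL(V)$, and $\Delta^\sigma W=\{(w,\sigma(w)):w\in W\}\subset W\times W^\sigma\subset GL(V)\times GL(V)$. The group $W\times W^\sigma$ acts on $\mathbb{C}[V\oplus V]=S(V^*\oplus V^* )\cong\mathbb{C}[x_1,\dots,x_n,y_1,\dots,y_n]$, preserving the $\mathbb{N}^2$-grading with $\deg x_i=(1,0)$, $\deg y_j=(0,1)$. The notation $(\mathbb{C}[V\oplus V]^{W\times W^\sigma}_+)$ denotes the ideal of $\mathbb{C}[V\oplus V]^{\Delta^\sigma W}$ generated by the $W\times W^\sigma$-invariants of positive degree. The Hilbert series of an $\mathbb{N}^2$-graded space $R$ is $\sum_{i,j}\dim_{\mathbb{C}}(R_{ij})\,t^iq^j$. *)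

(* Defs.v *)
From HB Require Import structures.
From mathcomp Require Import all_boot all_order all_fingroup all_algebra.
From mathcomp Require Import all_solvable all_field mxrepresentation.
From mathcomp Require Import boolp classical_sets reals complex mpoly.

Set Implicit Arguments.
Unset Strict Implicit.
Unset Printing Implicit Defensive.

Import Order.TTheory GRing.Theory Num.Theory.

Local Open Scope classical_set_scope.
Local Open Scope ring_scope.

Section Quotients.
Variables (F : fieldType) (V : lmodType F).

(* The images of b_0, ..., b_(d-1) form a basis of S / (S `&` I), for linear
   subspaces S and I of V. *)
Definition quotient_basis (S I : set V) (d : nat) (b : 'I_d -> V) : Prop :=
  (forall k, S (b k)) /\
  (forall v, S v -> exists! c : 'cV[F]_d, I (v - \sum_k c k 0 *: b k)).

Definition has_quotient_dim (S I : set V) (d : nat) : Prop :=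
  exists b : 'I_d -> V, quotient_basis S I b.

(* T is meant to be linear and to preserve S and I, and S / (S `&` I) to be
   finite-dimensional; the trace of the induced map is then independent of the
   basis b and M is its matrix (columns are images of basis vectors). *)
Definition quotient_trace (S I : set V) (T : V -> V) : F :=
  xget 0 [set a | exists (d : nat) (b : 'I_d -> V) (M : 'M[F]_d),
    [/\ quotient_basis S I b,
        forall k, I (T (b k) - \sum_l M l k *: b l)
      & a = \tr M]].

End Quotients.

(* The ideal of the subring S generated by P. *)
Definition ideal_in (R : nzRingType) (S P : set R) : set R :=
  [set r | exists s : seq (R * R),
    (forall ap, ap \in s -> S ap.1 /\ P ap.2) /\ r = \sum_(ap <- s) ap.1 * ap.2].

Section PolynomialAction.
Variables (F : fieldType) (n : nat).
Implicit Types (w : 'M[F]_n) (p : {mpoly F[n]}) (H : set 'M[F]_n).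

(* Matrices act on column vectors v, and (w . p)(v) = p (w^-1 v). *)
Definition poly_act w p : {mpoly F[n]} :=
  p \mPo [tuple \sum_(j < n) invmx w i j *: 'X_j | i < n].

Definition invariants H : set {mpoly F[n]} :=
  [set p | forall w, H w -> poly_act w p = p].

(* Invariants without constant term, i.e. the sums of homogeneous invariants of
   positive degree. *)
Definition invariants_pos H : set {mpoly F[n]} :=
  [set p | invariants H p /\ p@_0%MM = 0].

Definition hilbert_ideal H : set {mpoly F[n]} :=
  ideal_in setT (invariants_pos H).

Definition homog_part (d : nat) : set {mpoly F[n]} :=
  [set p | p \is d.-homog].

(* The fixed subspace of w acting on column vectors is the row space of
   eigenspace w^T 1. *)
Definition is_reflection w : bool := (n - \rank (eigenspace w^T 1) == 1)%N.

End PolynomialAction.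

(* F[V (+) V], with x_i = 'X_(lshift n i) and y_j = 'X_(rshift n j). *)
Definition bihomog_part (F : fieldType) (n i j : nat) :
    set {mpoly F[n + n]} :=
  [set p | forall m, m \in msupp p ->
    (\sum_(k < n) m (lshift n k) = i)%N /\ (\sum_(k < n) m (rshift n k) = j)%N].

Section Representations.
Variables (F : fieldType) (gT : finGroupType) (G : {group gT}).

(* A linear group W is the image of a faithful representation rW of a finite
   group G. *)
Definition reflection_group (n : nat) (rW : mx_representation F G n) : Prop :=
  mx_faithful rW /\ <<[set g in G | is_reflection (rW g)]>>%g = G.

Definition linear_group (n : nat) (r : mx_representation F G n) : set 'M[F]_n :=
  [set r g | g in [set g | g \in G]].

Definition mxchar (d : nat) (r : mx_representation F G d) : gT -> F :=
  fun g => \tr (r g).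

Section TwoActions.
Variables (n : nat) (rW rW' : mx_representation F G n).

(* w acts on the x variables, w' on the y variables. *)
Definition prod_group : set 'M[F]_(n + n) :=
  [set block_mx w 0 0 w' | w in linear_group rW & w' in linear_group rW'].

Definition diag_group : set 'M[F]_(n + n) :=
  [set block_mx (rW g) 0 0 (rW' g) | g in [set g | g \in G]].

Definition diag_ideal : set {mpoly F[n + n]} :=
  ideal_in (invariants diag_group) (invariants_pos prod_group).

(* h i j is the coefficient of t^i q^j in the Hilbert series of
   F[V (+) V]^diag / (F[V (+) V]^prod_+). *)
Definition is_diag_hilbert_series (h : nat -> nat -> F) : Prop :=
  forall i j, exists2 d : nat,
    has_quotient_dim (invariants diag_group `&` bihomog_part i j) diag_ideal d
    & h i j = d%:R.

End TwoActions.

Definition coinvariant_char (n : nat) (rW : mx_representation F G n) (i : nat) :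
    gT -> F :=
  fun g => quotient_trace (homog_part i) (hilbert_ideal (linear_group rW))
                          (poly_act (rW g)).

End Representations.

Section FakeDegrees.
Variables (C : numClosedFieldType) (gT : finGroupType) (G : {group gT}).

Definition char_inner (chi psi : gT -> C) : C :=
  #|G|%:R^-1 * \sum_(g in G) chi g * (psi g)^*.

(* Index type of the isomorphism classes of irreducible representations of G
   over C; irr_repr l is a representative of the class l. *)
Definition irr_index : irrType C G := DecSocleType (regular_repr C G).

(* Coefficient of q^i in the fake degree of lam. *)
Definition fake_degree (n : nat) (rW : mx_representation C G n)
    (d : nat) (lam : mx_representation C G d) (i : nat) : C :=
  char_inner (mxchar lam) (coinvariant_char rW i).

Definition conj_repr (d : nat) (lam : mx_representation C G d) :
    mx_representation C G d :=
  map_repr (Num.conj : {rmorphism C -> C}) lam.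

(* K plays the role of Q[e^(2 i pi / m)], embedded in C by iota. *)
Section Galois.
Variables (K : splittingFieldType rat) (iota : {rmorphism K -> C}).
Variable sigma : gal_of {:K}.

Definition extend_repr (d : nat) (r : mx_representation K G d) :
    mx_representation C G d := map_repr iota r.

Definition gal_repr_extend (d : nat) (r : mx_representation K G d) :
    mx_representation C G d :=
  map_repr (iota \o sigma : {rmorphism K -> C}) r.

(* Coefficient of t^i q^j in the sigma-bimahonian distribution; rho l is a
   matrix form over K of the irreducible representation l. *)
Definition bimahonian (n : nat) (rW : mx_representation K G n)
    (rho : forall l : irr_index, mx_representation K G (irr_degree l))
    (i j : nat) : C :=
  \sum_(l : irr_index)
    fake_degree (extend_repr rW) (gal_repr_extend (rho l)) i *
    fake_degree (extend_repr rW) (conj_repr (irr_repr l)) j.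

End Galois.
End FakeDegrees.

(* Main.v *)
(* Because averaging over the diagonal group maps the ideal J of C[V (+) V]
   generated by the invariants of W x W^sigma of positive degree onto the ideal
   that these generate among the diagonal invariants, the quotient ring of the
   theorem consists of the diagonal invariants of C[V (+) V] / J = A (x) A^sigma,
   where A^sigma is the coinvariant algebra of W^sigma. In bidegree (i, j) its
   dimension is thus the average over w in W of the product of the characters
   of A_i and of A^sigma_j. The latter is the image under sigma of the character
   of A_j, because A is defined over the cyclotomic field. Expanding the
   character of A_j into irreducible characters, with coefficients that sigma
   fixes because they are integers, turns this average into a sum of products
   of fake degrees. *)
From HB Require Import structures.
Require Import Defs.
From mathcomp Require Import all_boot all_order all_fingroup all_algebra.
From mathcomp Require Import all_solvable all_field mxrepresentation.
From mathcomp Require Import boolp classical_sets reals complex ssrcomplements mpoly.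

Set Implicit Arguments.
Unset Strict Implicit.
Unset Printing Implicit Defensive.

Import Order.TTheory GRing.Theory Num.Theory.

Local Open Scope classical_set_scope.
Local Open Scope ring_scope.

(** * Bases and traces on quotient spaces *)

Section QuotientBasis.
Variables (F : fieldType) (V : lmodType F).
Implicit Types (S I : set V) (v : V).

Definition subspace I := I 0 /\ forall a u v, I u -> I v -> I (a *: u + v).

Lemma subspaceD I u v : subspace I -> I u -> I v -> I (u + v).
Proof. by move=> [_ ID] Iu Iv; rewrite -[u]scale1r; apply: ID. Qed.

Lemma subspaceZ I a v : subspace I -> I v -> I (a *: v).
Proof. by move=> [I0 ID] Iv; rewrite -[_ *: _]addr0; apply: ID. Qed.

Lemma subspaceB I u v : subspace I -> I u -> I v -> I (u - v).
Proof.
by move=> sI Iu Iv; apply: subspaceD => //; rewrite -scaleN1r; apply: subspaceZ.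
Qed.

Lemma subspace_sum I (T : Type) (r : seq T) (P : pred T) (f : T -> V) :
  subspace I -> (forall i, P i -> I (f i)) -> I (\sum_(i <- r | P i) f i).
Proof.
move=> sI If; apply: big_ind => //; first by case: sI.
by move=> u v; apply: subspaceD.
Qed.

Lemma subspaceI S I : subspace S -> subspace I -> subspace (S `&` I).
Proof.
move=> [S0 SD] [I0 ID]; split=> // a u v [Su Iu] [Sv Iv].
by split; [apply: SD | apply: ID].
Qed.

(** A quotient basis tests membership in [I] only on differences that stay in [S]. This allows one
    ideal to be traded for another that agrees with it on the invariants. *)
Lemma has_quotient_dim_eq S I1 I2 d : subspace S ->
  S `&` I1 = S `&` I2 -> has_quotient_dim S I1 d -> has_quotient_dim S I2 d.
Proof.
move=> sS eqI [b [Sb bP]]; exists b; split=> // v Sv.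
have Sc (c : 'cV_d) : S (v - \sum_k c k 0 *: b k).
  apply: subspaceB => //; apply: subspace_sum => // k _; exact: subspaceZ.
have IE (c : 'cV_d) : I1 (v - \sum_k c k 0 *: b k) <-> I2 (v - \sum_k c k 0 *: b k).
  have := congr1 (fun A : set V => A (v - \sum_k c k 0 *: b k)) eqI.
  rewrite /setI /mkset => E; split=> Ic.
    by have [] : (S `&` I2) (v - \sum_k c k 0 *: b k) by rewrite -eqI.
  by have [] : (S `&` I1) (v - \sum_k c k 0 *: b k) by rewrite eqI.
have [c [Ic uc]] := bP v Sv.
by exists c; split=> [|c' /IE/uc//]; apply/IE.
Qed.

(* A generating family of minimal size modulo I is a basis. *)
Lemma exists_quotient_basis S I N (v : 'I_N -> V) :
    subspace S -> subspace I -> (forall i, S (v i)) ->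
    (forall x, S x -> exists c : 'cV[F]_N, x = \sum_i c i 0 *: v i) ->
  exists d, has_quotient_dim S I d.
Proof.
move=> sS sI Sv vP.
pose gen d := exists b : 'I_d -> V, (forall k, S (b k)) /\
  forall x, S x -> exists c : 'cV[F]_d, I (x - \sum_k c k 0 *: b k).
have exgen : exists d, `[< gen d >].
  exists N; apply/asboolP; exists v; split=> // x /vP[c ->].
  by exists c; rewrite subrr; case: sI.
case: (ex_minnP exgen) => d /asboolP[b [Sb bP]] dmin.
exists d, b; split=> // x Sx; have [c Ic] := bP x Sx.
exists c; split=> // c' Ic'; apply/eqP; rewrite -subr_eq0; apply/eqP.
set e := c - c'.
have Ie : I (\sum_k e k 0 *: b k).
  have := subspaceB sI Ic' Ic; rewrite opprB addrC addrA subrK -sumrB.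
  congr (I _); apply: eq_bigr => k _; by rewrite !mxE scalerBl.
apply/matrixP => k j; rewrite ord1 [RHS]mxE {j}.
apply/eqP/negPn/negP => ek.
case: d => [|d] in b Sb bP dmin c Ic c' Ic' e Ie k ek *; first by case: k ek.
(* Since [e k] is nonzero, the relation [Ie] expresses [b k] modulo [I] through the other
   generators, so [d] of them already generate, against minimality. *)
suff /dmin : `[< gen d >] by rewrite ltnn.
apply/asboolP; exists (fun j => b (lift k j)); split=> // y Sy.
have [a Ia] := bP y Sy.
(* Subtracting [a k / e k] times the relation from the expansion of [y] cancels the coefficient of
   [b k]. *)
exists (\col_j (a (lift k j) 0 - a k 0 / e k 0 * e (lift k j) 0)).
have := subspaceD sI Ia (subspaceZ (a k 0 / e k 0) sI Ie).
congr (I _); rewrite -addrA; congr (_ + _).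
rewrite !(bigD1_ord k) //=.
rewrite scalerDr scalerA divfK // opprD addrACA addNr add0r.
rewrite scaler_sumr addrC -sumrB -sumrN; apply: eq_bigr => j _.
by rewrite mxE scalerA scalerBl opprB.
Qed.

(** For [v] in [S] a quotient basis leaves exactly one candidate; the default 0 matters only when
    there is none, hence the assumptions [S v] below. *)
Definition quotient_coord I d (b : 'I_d -> V) v : 'cV[F]_d :=
  xget 0 [set c : 'cV[F]_d | I (v - \sum_k c k 0 *: b k)].

Section Coordinates.
Variables (S I : set V) (d : nat) (b : 'I_d -> V).
Hypotheses (sS : subspace S) (sI : subspace I) (Sb : quotient_basis S I b).
Local Notation coord := (quotient_coord I b).

Lemma quotient_coordP v : S v -> I (v - \sum_k coord v k 0 *: b k).
Proof.
move=> Sv; have [c [Ic _]] := Sb.2 v Sv.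
by rewrite /quotient_coord; case: xgetP => [c' _ //|/(_ c)].
Qed.

Lemma quotient_coordE v (c : 'cV_d) :
  S v -> I (v - \sum_k c k 0 *: b k) -> coord v = c.
Proof.
move=> Sv Ic; have [c' [_ uc]] := Sb.2 v Sv.
by rewrite -(uc _ Ic) -(uc _ (quotient_coordP Sv)).
Qed.

Lemma quotient_coord_basis k : coord (b k) = delta_mx k 0.
Proof.
apply: quotient_coordE; first exact: Sb.1.
rewrite (bigD1 k) //= mxE !eqxx scale1r big1 ?addr0 ?subrr; first by case: sI.
by move=> j jk; rewrite mxE (negPf jk) scale0r.
Qed.

Lemma quotient_coordD a u v :
  S u -> S v -> coord (a *: u + v) = a *: coord u + coord v.
Proof.
move=> Su Sv; apply: quotient_coordE; first by apply: sS.2.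
have := sI.2 a _ _ (quotient_coordP Su) (quotient_coordP Sv).
congr (I _); rewrite scalerBr addrACA -opprD; congr (_ - _).
rewrite scaler_sumr -big_split; apply: eq_bigr => k _ /=.
by rewrite !mxE scalerDl scalerA.
Qed.

Lemma quotient_coord0 v : S v -> I v -> coord v = 0.
Proof.
move=> Sv Iv; apply: quotient_coordE => //.
by rewrite big1 ?subr0 // => k _; rewrite mxE scale0r.
Qed.

Lemma quotient_coord_eq0 v : S v -> coord v = 0 -> I v.
Proof.
move=> Sv v0; have := quotient_coordP Sv.
by rewrite v0 big1 ?subr0 // => k _; rewrite mxE scale0r.
Qed.

Lemma quotient_coord_sum (T : Type) (r : seq T) (a : T -> F) (f : T -> V) :
    (forall i, S (f i)) ->
  coord (\sum_(i <- r) a i *: f i) = \sum_(i <- r) a i *: coord (f i).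
Proof.
move=> Sf; elim: r => [|i r IH].
  by rewrite !big_nil; apply: quotient_coord0; [case: sS | case: sI].
rewrite !big_cons quotient_coordD ?IH //.
by apply: subspace_sum => // j _; apply: subspaceZ.
Qed.

Lemma quotient_coord_lincomb (c : 'cV_d) : coord (\sum_k c k 0 *: b k) = c.
Proof.
apply: quotient_coordE; last by rewrite subrr; case: sI.
by apply: subspace_sum => // k _; apply: subspaceZ => //; apply: Sb.1.
Qed.

Lemma quotient_coord_linear (T : {linear V -> V}) v (M : 'M[F]_d) :
    (forall u, S u -> S (T u)) -> (forall u, I u -> I (T u)) ->
    (forall k, I (T (b k) - \sum_l M l k *: b l)) ->
  S v -> coord (T v) = M *m coord v.
Proof.
move=> TS TI TM Sv.
have TME k : coord (T (b k)) = col k M.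
  apply: quotient_coordE; first by apply: TS; apply: Sb.1.
  by under eq_bigr do rewrite mxE; apply: TM.
have Tc : I (T v - \sum_k coord v k 0 *: T (b k)).
  have := TI _ (quotient_coordP Sv); rewrite linearB /= linear_sum /=.
  by under eq_bigr do rewrite linearZ_LR /=.
have STb k : S (T (b k)) by apply: TS; apply: Sb.1.
have SE : S (\sum_k coord v k 0 *: T (b k)).
  by apply: subspace_sum => // k _; apply: subspaceZ.
(* [T v] is split into the combination of the [T (b k)] and a remainder, which lies in [I] and so
   has coordinates 0. *)
have := quotient_coordD 1 (subspaceB sS (TS _ Sv) SE) SE.
rewrite !scale1r subrK => ->.
rewrite (quotient_coord0 (subspaceB sS (TS _ Sv) SE) Tc) add0r.
rewrite quotient_coord_sum //; apply/matrixP => i j; rewrite ord1 summxE mxE.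
by apply: eq_bigr => k _; rewrite TME !mxE mulrC.
Qed.

End Coordinates.

(** The basis picked by [xget] may differ from [b], but the change of basis matrices satisfy
    [P *m Q = 1] and [M' = Q *m M *m P], so cyclicity of the trace identifies the two traces. *)
Lemma quotient_traceE S I (T : {linear V -> V}) d (b : 'I_d -> V) (M : 'M[F]_d) :
    subspace S -> subspace I ->
    (forall u, S u -> S (T u)) -> (forall u, I u -> I (T u)) ->
    quotient_basis S I b -> (forall k, I (T (b k) - \sum_l M l k *: b l)) ->
  quotient_trace S I T = \tr M.
Proof.
move=> sS sI TS TI Sb TM; rewrite /quotient_trace.
case: xgetP => [_ -> [d' [b' [M' [Sb' TM' ->]]]]|/(_ (\tr M))]; last first.
  by case; exists d, b, M.
pose P : 'M[F]_(d, d') := \matrix_(i, j) quotient_coord I b (b' j) i 0.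
pose Q : 'M[F]_(d', d) := \matrix_(i, j) quotient_coord I b' (b j) i 0.
have change e e' (c : 'I_e -> V) (c' : 'I_e' -> V) v :
    quotient_basis S I c -> quotient_basis S I c' -> S v ->
  quotient_coord I c' v =
    (\matrix_(i, j) quotient_coord I c' (c j) i 0) *m quotient_coord I c v.
  move=> Sc Sc' Sv.
  have SE : S (\sum_k quotient_coord I c v k 0 *: c k).
    by apply: subspace_sum => // k _; apply: subspaceZ => //; apply: Sc.1.
  have SB := subspaceB sS Sv SE.
  have := quotient_coordD sS sI Sc' 1 SB SE; rewrite !scale1r subrK => ->.
  rewrite (quotient_coord0 Sc' SB) ?add0r; last first.
    exact: (quotient_coordP Sc Sv).
  rewrite (quotient_coord_sum sS sI Sc') //; last exact: Sc.1.
  apply/matrixP => i j; rewrite ord1 summxE mxE.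
  by apply: eq_bigr => k _; rewrite !mxE mulrC.
have PQ1 : P *m Q = 1%:M.
  apply/matrixP => i j.
  transitivity ((P *m quotient_coord I b' (b j)) i 0).
    by rewrite !mxE; apply: eq_bigr => k _; rewrite [Q _ _]mxE.
  rewrite -(change _ _ _ _ _ Sb' Sb) ?(quotient_coord_basis sI Sb) ?mxE ?eqxx ?andbT //.
  exact: Sb.1.
have M'E : M' = Q *m M *m P.
  apply/matrixP => i j.
  have Sj := Sb'.1 j.
  transitivity (quotient_coord I b' (T (b' j)) i 0).
    rewrite (quotient_coord_linear sS sI Sb' TS TI TM' Sj).
    rewrite (quotient_coord_basis sI Sb') mxE (bigD1 j) //= !mxE !eqxx mulr1.
    by rewrite big1 ?addr0 // => k kj; rewrite mxE (negPf kj) mulr0.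
  rewrite (change _ _ _ _ _ Sb Sb'); last exact: TS.
  rewrite (quotient_coord_linear sS sI Sb TS TI TM Sj) mulmxA !mxE.
  by apply: eq_bigr => k _; rewrite [P _ _]mxE.
by rewrite M'E -mulmxA mxtrace_mulC -mulmxA PQ1 mulmx1.
Qed.

End QuotientBasis.

(** In a rank factorization [P = C *m R], the full rank factors can be cancelled from
    [C R C R = C R]. It follows that the trace of [P] is the image of its rank in [F]. *)
Lemma idempotent_factor (F : fieldType) d (P : 'M[F]_d) :
    P *m P = P ->
  exists r (C : 'M[F]_(d, r)) (R : 'M[F]_(r, d)), C *m R = P /\ R *m C = 1%:M.
Proof.
move=> PP.
have E : col_base P *m row_base P *m (col_base P *m row_base P) =
  col_base P *m row_base P by rewrite mulmx_base.
exists (\rank P), (col_base P), (row_base P); split; first exact: mulmx_base.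
have /row_freeP := row_base_free P; have /row_fullP := col_base_full P.
move: (col_base P) (row_base P) E => C R E [C' CC'] [R' RR'].
have := congr1 (fun A => C' *m A *m R') E.
by rewrite /= !mulmxA CC' mul1mx -!mulmxA RR' !mulmx1.
Qed.

(** * Finite group actions on a quotient space and their invariants *)

Section QuotientRepr.
Variables (F : fieldType) (V : lmodType F) (gT : finGroupType) (G : {group gT}).
Variables (S I : set V) (d : nat) (b : 'I_d -> V) (T : gT -> {linear V -> V}).
Hypotheses (sS : subspace S) (sI : subspace I) (Sb : quotient_basis S I b).
Hypotheses (TS : forall g u, g \in G -> S u -> S (T g u)).
Hypotheses (TI : forall g u, g \in G -> I u -> I (T g u)).
Hypotheses (T1 : forall u, T 1%g u = u).
Hypotheses (TM : forall g h u, g \in G -> h \in G -> T (g * h)%g u = T g (T h u)).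

Definition quotient_mx g : 'M[F]_d :=
  \matrix_(l, k) quotient_coord I b (T g (b k)) l 0.

Lemma quotient_mxP g k : g \in G ->
  I (T g (b k) - \sum_l quotient_mx g l k *: b l).
Proof.
move=> Gg; under eq_bigr do rewrite mxE.
by apply: (quotient_coordP Sb); apply: TS => //; apply: Sb.1.
Qed.

Lemma quotient_mx_coord g v : g \in G -> S v ->
  quotient_coord I b (T g v) = quotient_mx g *m quotient_coord I b v.
Proof.
move=> Gg; apply: (quotient_coord_linear sS sI Sb).
- by move=> u; apply: TS.
- by move=> u; apply: TI.
by move=> k; apply: quotient_mxP.
Qed.

Lemma quotient_mx_repr : mx_repr G quotient_mx.
Proof.
split=> [|g h Gg Gh]; apply/matrixP => i j.
  by rewrite mxE T1 (quotient_coord_basis sI Sb) !mxE eqxx andbT.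
have Sj := Sb.1 j.
rewrite mxE TM // quotient_mx_coord //; last exact: TS.
by rewrite !mxE; apply: eq_bigr => k _; rewrite [quotient_mx h _ _]mxE.
Qed.
Definition quotient_repr := MxRepresentation quotient_mx_repr.

(** The mean [P] of the matrices of the action is an idempotent projecting onto the invariants, so
    its trace is their dimension. Averaging representatives in [S] lifts invariant classes to honest
    invariants. *)
Lemma quotient_invariants_dim : #|G|%:R != 0 :> F ->
  exists2 e, has_quotient_dim (S `&` [set v | forall g, g \in G -> T g v = v]) I e
  & #|G|%:R^-1 * \sum_(g in G) \tr (quotient_mx g) = e%:R.
Proof.
move=> G0; pose P := #|G|%:R^-1 *: \sum_(g in G) quotient_mx g.
have MP h : h \in G -> quotient_mx h *m P = P.
  move=> Gh; rewrite -scalemxAr; congr (_ *: _); rewrite mulmx_sumr.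
  rewrite [RHS](reindex_inj (mulgI h)) /=.
  by apply: eq_big => g; rewrite ?groupMl // => Gg; rewrite -quotient_mx_repr.2.
have PP : P *m P = P.
  rewrite {1}/P -scalemxAl mulmx_suml (eq_bigr (fun=> P)) //.
  by rewrite sumr_const -scaler_nat scalerA mulVf // scale1r.
have [r [C [R [CR RC]]]] := idempotent_factor PP.
exists r; last first.
  rewrite -(mxtrace1 _ r) -RC mxtrace_mulC CR mxtraceZ; congr (_ * _).
  by rewrite raddf_sum.
pose rey v := #|G|%:R^-1 *: \sum_(g in G) T g v.
have Srey v : S v -> S (rey v).
  move=> Sv; apply: subspaceZ => //; apply: subspace_sum => // g Gg; exact: TS.
have reyP v g : g \in G -> T g (rey v) = rey v.
  move=> Gg; rewrite linearZ_LR /= linear_sum /=; congr (_ *: _).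
  rewrite [RHS](reindex_inj (mulgI g)) /=.
  by apply: eq_big => h; rewrite ?groupMl // => Gh; rewrite TM.
have coord_rey v : S v -> quotient_coord I b (rey v) = P *m quotient_coord I b v.
  move=> Sv; rewrite /rey scaler_sumr big_mkcond /=.
  rewrite (eq_bigr (fun g => (if g \in G then #|G|%:R^-1 else 0) *:
                             (if g \in G then T g v else 0))); last first.
    by move=> g _; case: ifP => // _; rewrite scaler0.
  rewrite (quotient_coord_sum sS sI Sb) //; last first.
    by move=> g; case: ifP => Gg; [apply: TS | case: sS].
  rewrite -scalemxAl mulmx_suml scaler_sumr [RHS]big_mkcond; apply: eq_bigr => g _ /=.
  by case: ifP => Gg; rewrite ?quotient_mx_coord // scale0r.
have coord_inv v : S v -> (forall g, g \in G -> T g v = v) ->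
    quotient_coord I b v = P *m quotient_coord I b v.
  move=> Sv vG; rewrite -coord_rey // /rey (eq_bigr _ vG) sumr_const.
  by rewrite -scaler_nat scalerA mulVf // scale1r.
(* The columns of [C] span the image of [P]; [u s] is a representative with these coordinates, and
   averaging it keeps the coordinates because [P] fixes them. *)
pose u s := \sum_k col s C k 0 *: b k.
have Su s : S (u s).
  by apply: subspace_sum => // k _; apply: subspaceZ => //; apply: Sb.1.
have coord_reyu s : quotient_coord I b (rey (u s)) = col s C.
  rewrite coord_rey // (quotient_coord_lincomb sS sI Sb) -CR.
  by rewrite !colE mulmxA -(mulmxA C) RC mulmx1.
exists (fun s => rey (u s)); split.
  by move=> s; split; [exact: Srey | move=> g; exact: reyP].
move=> v [Sv vG].
have Sc (c : 'cV_r) : S (\sum_k c k 0 *: rey (u k)).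
  by apply: subspace_sum => // k _; apply: subspaceZ => //; apply: Srey.
have coord_c (c : 'cV_r) :
    quotient_coord I b (v - \sum_k c k 0 *: rey (u k)) =
    quotient_coord I b v - C *m c.
  rewrite addrC -scaleN1r (quotient_coordD sS sI Sb) // scaleN1r addrC.
  congr (_ - _); rewrite (quotient_coord_sum sS sI Sb) //; last first.
    by move=> k; apply: Srey.
  apply/matrixP => i j; rewrite ord1 summxE mxE; apply: eq_bigr => k _.
  by rewrite coord_reyu !mxE mulrC.
(* [C *m R = P] fixes the coordinates of an invariant, which gives existence; [R *m C = 1] gives
   uniqueness. *)
exists (R *m quotient_coord I b v); split=> [|c Ic].
  apply: (quotient_coord_eq0 Sb); first exact: subspaceB.
  by rewrite coord_c mulmxA CR -coord_inv ?subrr.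
have : quotient_coord I b v - C *m c = 0.
  by rewrite -coord_c (quotient_coord0 Sb) //; apply: subspaceB.
by move/subr0_eq ->; rewrite mulmxA RC mul1mx.
Qed.

End QuotientRepr.

(** * Characters of a finite group over an algebraically closed field *)

Section Characters.
Variables (C : numClosedFieldType) (gT : finGroupType) (G : {group gT}).

Lemma natr_cardG_neq0 (F : numFieldType) : #|G|%:R != 0 :> F.
Proof. by rewrite pnatr_eq0 -lt0n cardG_gt0. Qed.

Lemma pchar'_numField : ([pchar C]^').-group%g G.
Proof. by apply/pgroupP => p _ _; rewrite inE /= pchar_num. Qed.

(** Schur's lemma: the kernel and the image of an intertwiner are submodules, so irreducibility
    forces a nonzero one to be invertible. *)
Lemma Schur_rsim n1 n2 (r1 : mx_representation C G n1)
    (r2 : mx_representation C G n2) (f : 'M[C]_(n1, n2)) :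
    mx_irreducible r1 -> mx_irreducible r2 ->
    (forall g, g \in G -> r1 g *m f = f *m r2 g) -> f != 0 -> mx_rsim r1 r2.
Proof.
move=> /mx_irrP[n1_gt0 irr1] /mx_irrP[n2_gt0 irr2] homf nzf.
have kerf0 : kermx f == 0.
  apply/negPn/negP => nz; have /irr1/(_ nz) : mxmodule r1 (kermx f).
    apply/mxmoduleP => g Gg; apply/sub_kermxP.
    by rewrite -mulmxA homf // mulmxA mulmx_ker mul0mx.
  rewrite -sub1mx => /sub_kermxP; rewrite mul1mx => f0.
  by rewrite f0 eqxx in nzf.
have imf : row_full f.
  have /irr2 : mxmodule r2 <<f>>%MS.
    rewrite (eqmx_module _ (genmxE f)); apply/mxmoduleP => g Gg.
    by rewrite -homf // submxMl.
  rewrite -mxrank_eq0 genmxE mxrank_eq0 => /(_ nzf).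
  by rewrite /row_full genmxE.
have freef : row_free f by rewrite -kermx_eq0.
have n12 : n1 = n2 by rewrite -(eqP freef) (eqP imf).
exact: MxReprSim n12 freef homf.
Qed.

Lemma mulmx_delta_mx m n p q (A : 'M[C]_(m, n)) (B : 'M[C]_(p, q)) a b i j :
  (A *m delta_mx a b *m B) i j = A i a * B b j.
Proof.
rewrite mxE (bigD1 b) //= mxE (bigD1 a) //= !mxE !eqxx mulr1.
rewrite [X in (_ + X) * _]big1 ?addr0; last first.
  by move=> k ka; rewrite mxE (negPf ka) mulr0.
rewrite big1 ?addr0 // => k kb; rewrite mxE big1 ?mul0r // => l _.
by rewrite mxE (negPf kb) andbF mulr0.
Qed.

Section Averages.
Variables (n1 n2 : nat) (r1 : mx_representation C G n1).
Variable (r2 : mx_representation C G n2).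

(** Summing the conjugates of a matrix unit over [G] produces an intertwiner whose entries are sums
    of products of matrix coefficients, to which Schur's lemma applies. *)
Definition average_hom (a : 'I_n1) (b : 'I_n2) : 'M[C]_(n1, n2) :=
  \sum_(g in G) r1 g^-1%g *m delta_mx a b *m r2 g.

Lemma average_homP a b h : h \in G ->
  r1 h *m average_hom a b = average_hom a b *m r2 h.
Proof.
move=> Gh; rewrite mulmx_sumr mulmx_suml (reindex_inj (mulIg h)) /=.
apply: eq_big => g; rewrite ?groupMr // => Gg.
rewrite invMg !repr_mxM ?groupV //.
by rewrite !mulmxA -repr_mxM ?groupV // mulgV repr_mx1 mul1mx.
Qed.

(** The entry of index [a], [b] of the sum built on the matrix unit [a], [b] involves only diagonal
    coefficients, whose sums are the two traces. *)
Lemma sum_average_hom :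
  \sum_a \sum_b average_hom a b a b =
  \sum_(g in G) \tr (r1 g^-1%g) * \tr (r2 g).
Proof.
under eq_bigr do under eq_bigr do rewrite /average_hom summxE.
under eq_bigr do rewrite exchange_big /=.
rewrite exchange_big; apply: eq_bigr => g Gg.
rewrite big_distrl /=; apply: eq_bigr => a _.
by rewrite big_distrr /=; apply: eq_bigr => b _; rewrite mulmx_delta_mx.
Qed.

End Averages.

Local Notation irr := (irr_index C G).

(** By Schur's lemma the averaged matrix units vanish between non-isomorphic irreducibles and are
    scalar otherwise. *)
Lemma irr_char_orthogonality (i j : irr) :
  \sum_(g in G) \tr (irr_repr i g^-1%g) * \tr (irr_repr j g) =
  #|G|%:R * (i == j)%:R.
Proof.
have irri k : mx_irreducible (irr_repr (k : irr)) := socle_irr k.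
rewrite -sum_average_hom; have [<-{j}|neq_ij] := eqVneq i j; last first.
  rewrite mulr0 big1 // => a _; rewrite big1 // => b _.
  set T := average_hom _ _ _ _.
  have [->|nzT] := eqVneq T 0; first by rewrite mxE.
  have sim : mx_rsim (irr_repr i) (irr_repr j).
    by apply: Schur_rsim nzT => // g; apply: average_homP.
  have := irr_comp_rsim_pchar (irr_index C G) pchar'_numField sim.
  rewrite !(irr_reprK_pchar pchar'_numField) => ij.
  by rewrite ij eqxx in neq_ij.
set r := irr_repr i.
have d_neq0 : (irr_degree i)%:R != 0 :> C.
  by rewrite pnatr_eq0 -lt0n; have /mx_irrP[] := irri i.
(* The scalar is read off from the trace: each conjugate of the matrix unit has trace 1 if [a == b]
   and 0 otherwise. *)
have TE a b : average_hom r r a b = (#|G|%:R / (irr_degree i)%:R * (a == b)%:R)%:M.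
  have /is_scalar_mxP[c Tc] : is_scalar_mx (average_hom r r a b).
    apply: (mx_abs_irr_cent_scalar (group_closure_closed_field (irri i))).
    by apply/centgmxP => g Gg; rewrite average_homP.
  have : \tr (average_hom r r a b) = #|G|%:R * (a == b)%:R.
    rewrite raddf_sum /= (eq_bigr (fun=> (a == b)%:R)); last first.
      move=> g Gg; rewrite -mulmxA mxtrace_mulC -mulmxA -repr_mxM ?groupV //.
      rewrite mulgV repr_mx1 mulmx1 /mxtrace (bigD1 a) //= big1 ?addr0.
        by rewrite mxE eqxx.
      by move=> k ka; rewrite mxE (negPf ka).
    by rewrite sumr_const mulr_natl.
  rewrite Tc mxtrace_scalar => Ec; congr _%:M.
  by rewrite mulrAC -Ec -[c *+ _]mulr_natr mulfK.
rewrite (eq_bigr (fun=> #|G|%:R / (irr_degree i)%:R)); last first.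
  move=> a _; rewrite (bigD1 a) //= TE mxE !eqxx mulr1 big1 ?addr0 //.
  by move=> b ba; rewrite TE mxE eq_sym (negPf ba) mulr0n.
by rewrite sumr_const card_ord mulr1 -[LHS]mulr_natr divfK.
Qed.

(** Induction on the dimension: a simple submodule is split off, and the trace is additive over the
    submodule and the factor module. *)
Lemma char_irr_sum n (r : mx_representation C G n) :
  exists m : irr -> nat, forall g, g \in G ->
    \tr (r g) = \sum_l (m l)%:R * \tr (irr_repr l g).
Proof.
have [k] := ubnP n; elim: k n r => // k IH [|n] r ltnk.
  exists (fun=> 0) => g _; rewrite /mxtrace big_ord0 big1 // => l _.
  by rewrite mul0r.
have nz1 : 1%:M != 0 :> 'M[C]_n.+1 by rewrite -mxrank_eq0 mxrank1.
have [V simV _] := dec_mxsimple_exists (mxmodule1 r) nz1.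
have [modV nzV _] := simV.
have irrV : mx_irreducible (submod_repr modV) by apply/submod_mx_irr.
have V_gt0 : (0 < \rank V)%N by rewrite lt0n mxrank_eq0.
have [|m Hm] := IH _ (factmod_repr modV).
  by rewrite mxrank_coker; apply: (@leq_trans n.+1); first by rewrite ltn_subrL V_gt0.
pose l0 : irr := irr_comp (irr_index C G) (submod_repr modV).
have sim := rsim_irr_comp_pchar (irr_index C G) pchar'_numField irrV.
exists (fun l => (m l + (l == l0))%N) => g Gg.
rewrite -(mxtrace_sub_fact_mod modV) Hm // (mxtrace_rsim sim) //.
under [RHS]eq_bigr do rewrite natrD mulrDl.
rewrite big_split /= addrC; congr (_ + _).
rewrite (bigD1 l0) //= eqxx mul1r big1 ?addr0 // => l /negPf->.
by rewrite mul0r.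
Qed.

(** Weyl's unitary trick: averaging yields an invariant positive definite Hermitian matrix [H],
    which makes the adjoint of [r g] conjugate to [r g^-1]. *)
Lemma conj_mxtrace_repr n (r : mx_representation C G n) g : g \in G ->
  (\tr (r g))^* = \tr (r g^-1%g).
Proof.
move=> Gg; pose adj (A : 'M[C]_n) := (map_mx Num.conj A)^T.
pose H := \sum_(h in G) r h *m adj (r h).
have adjM A B : adj (A *m B) = adj B *m adj A.
  by rewrite /adj map_mxM trmx_mul.
have HgE : r g *m H *m adj (r g) = H.
  rewrite mulmx_sumr mulmx_suml [RHS](reindex_inj (mulgI g)) /=.
  apply: eq_big => h; rewrite ?groupMl // => Gh.
  by rewrite repr_mxM // adjM !mulmxA.
(* For [v] in the kernel of [H], the number [v H v^*] is a vanishing sum of squared norms of the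
   [v *m r h]; the term [h = 1] gives [v = 0]. *)
have unitH : H \in unitmx.
  rewrite -row_free_unit -kermx_eq0; apply/eqP/row_matrixP => i.
  rewrite row0; set v := row i _.
  have vH : v *m H = 0 by rewrite -row_mul mulmx_ker row0.
  pose f h := \sum_k `|(v *m r h) 0 k| ^+ 2.
  have f_ge0 h : 0 <= f h by apply: sumr_ge0 => k _; rewrite exprn_ge0.
  have : \sum_(h in G) f h = 0.
    transitivity ((v *m H *m (map_mx Num.conj v)^T) 0 0); last first.
      by rewrite vH mul0mx mxE.
    rewrite mulmx_sumr mulmx_suml summxE; apply: eq_bigr => h Gh.
    rewrite mulmxA -mulmxA -trmx_mul -map_mxM mxE; apply: eq_bigr => k _.
    by rewrite normCK !mxE.
  move/psumr_eq0P => /(_ (fun h _ => f_ge0 h)) /(_ _ (group1 G)).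
  rewrite /f repr_mx1 mulmx1 => /psumr_eq0P f0.
  apply/rowP => k; rewrite [RHS]mxE; apply/eqP.
  by rewrite -normr_eq0 -sqrf_eq0 f0 // => j _; rewrite exprn_ge0.
have -> : (\tr (r g))^* = \tr (adj (r g)).
  by rewrite mxtrace_tr /mxtrace rmorph_sum; apply: eq_bigr => k _; rewrite mxE.
have -> : adj (r g) = invmx H *m (r g^-1%g *m H).
  rewrite -{2}HgE -!mulmxA !(mulmxA (r g^-1%g)) -repr_mxM ?groupV //.
  by rewrite mulVg repr_mx1 mul1mx mulKmx.
by rewrite mulmxA mxtrace_mulC mulmxA mulmxV // mul1mx.
Qed.

End Characters.

(** * Averages and Hilbert ideals *)

Section LinearExtension.
Variables (F : fieldType) (n : nat) (V : lmodType F).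

Definition mpoly_lift (c : 'X_{1..n} -> V) (p : {mpoly F[n]}) : V :=
  \sum_(m <- msupp p) p@_m *: c m.

Variable c : 'X_{1..n} -> V.

(** A common index range makes the sums for polynomials with different supports addable term by
    term. *)
Lemma mpoly_liftwE k p : (msize p <= k)%N ->
  mpoly_lift c p = \sum_(m : 'X_{1..n < k}) p@_m *: c m.
Proof.
move=> lepk; pose I : subFinType _ := 'X_{1..n < k}.
rewrite /mpoly_lift (big_mksub I) ?msupp_uniq //=; first last.
  by move=> x /msize_mdeg_lt /leq_trans; apply.
by rewrite big_rmcond //= => m; move/memN_msupp_eq0 ->; rewrite scale0r.
Qed.

Lemma mpoly_lift_is_linear : linear (mpoly_lift c).
Proof.
move=> a p q; pose k := maxn (msize (a *: p + q)) (maxn (msize p) (msize q)).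
rewrite !(@mpoly_liftwE k) ?leq_max ?leqnn ?orbT //.
rewrite scaler_sumr -big_split /=; apply: eq_bigr => m _.
by rewrite mcoeffD mcoeffZ scalerDl scalerA.
Qed.

HB.instance Definition _ :=
  GRing.isLinear.Build F {mpoly F[n]} V _ (mpoly_lift c) mpoly_lift_is_linear.

Lemma mpoly_liftX m : mpoly_lift c 'X_[m] = c m.
Proof. by rewrite /mpoly_lift msuppX big_seq1 mcoeffX eqxx scale1r. Qed.

End LinearExtension.

Lemma mpoly_lin_ind (F : fieldType) (n : nat) (P : set {mpoly F[n]}) :
  subspace P -> (forall m, P 'X_[m]) -> forall p, P p.
Proof.
move=> sP PX p; rewrite [p]mpolyE; apply: subspace_sum => // m _.
exact: subspaceZ.
Qed.

(** * The action of matrices on polynomials *)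

Section Action.
Variables (F : fieldType) (n : nat).
Implicit Types (w : 'M[F]_n) (p q : {mpoly F[n]}).

HB.instance Definition _ w :=
  GRing.LRMorphism.copy (@poly_act F n w)
    (comp_mpoly [tuple \sum_(j < n) invmx w i j *: 'X_j | i < n]).

Lemma poly_actX w m :
  poly_act w 'X_[m] = \prod_(i < n) (\sum_(j < n) invmx w i j *: 'X_j) ^+ m i.
Proof.
by rewrite /poly_act comp_mpolyX; apply: eq_bigr => i _; rewrite tnth_mktuple.
Qed.

Lemma poly_actXU w i : poly_act w 'X_i = \sum_(j < n) invmx w i j *: 'X_j.
Proof. by rewrite /poly_act comp_mpolyXU -tnth_nth tnth_mktuple. Qed.

Lemma poly_act1 p : poly_act 1%:M p = p.
Proof.
rewrite -[RHS]comp_mpoly_id /poly_act; congr (_ \mPo _).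
apply: eq_mktuple => i; rewrite invmx1 (bigD1 i) //= mxE eqxx scale1r.
rewrite big1 ?addr0 // => j ji; by rewrite mxE eq_sym (negPf ji) scale0r.
Qed.

Lemma poly_actM w w' p : w \in unitmx -> w' \in unitmx ->
  poly_act w (poly_act w' p) = poly_act (w *m w') p.
Proof.
move=> Uw Uw'; move: p; apply: mpoly_lin_ind => [|m].
  split=> [|a p q Ep Eq]; rewrite /mkset; first by rewrite !linear0.
  rewrite !linearP /= Ep Eq; reflexivity.
rewrite !poly_actX rmorph_prod; apply: eq_bigr => i _.
rewrite rmorphXn; congr (_ ^+ _) => /=; rewrite linear_sum /=.
under eq_bigr do rewrite linearZ_LR /= poly_actXU scaler_sumr.
rewrite exchange_big /=; apply: eq_bigr => k _.
have -> : invmx (w *m w') = invmx w' *m invmx w.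
  have Uww' : w *m w' \in unitmx by rewrite unitmx_mul Uw.
  by rewrite -[RHS](mulKmx Uww') -mulmxA (mulKVmx Uw') mulmxV // mulmx1.
by rewrite mxE scaler_suml; apply: eq_bigr => j _; rewrite scalerA.
Qed.

Lemma dhomog_poly_act d w p : p \is d.-homog -> poly_act w p \is d.-homog.
Proof.
move=> /dhomogP ph; rewrite [p]mpolyE linear_sum /= big_seq.
apply: rpred_sum => m /ph <-; rewrite linearZ_LR /=; apply: rpredZ.
have Xh i : \sum_(j < n) invmx w i j *: 'X_j \is 1.-homog.
  by apply: rpred_sum => j _; apply: rpredZ; rewrite dhomogX /= mdeg1.
rewrite poly_actX /= mdegE; elim/big_ind2: _ => [||i _].
- exact: dhomog1.
- by move=> ? ? ? ?; apply: dhomogM.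
by have := dhomogMn (m i) (Xh i); rewrite mul1n.
Qed.

Lemma subspace_homog d : subspace (@homog_part F n d).
Proof.
split=> [|a u v hu hv]; first exact: rpred0.
by apply: rpredD => //; apply: rpredZ.
Qed.

End Action.

Section HilbertIdeal.
Variables (F : fieldType) (n : nat) (H : set 'M[F]_n).
Implicit Types p q : {mpoly F[n]}.

Lemma subspace_ideal_in (S P : set {mpoly F[n]}) :
  (forall a u, S u -> S (a *: u)) -> subspace (ideal_in S P).
Proof.
move=> SZ; split=> [|a _ _ [s [Ss ->]] [t [St ->]]].
  by exists [::]; split=> //; rewrite big_nil.
exists ([seq (a *: x.1, x.2) | x <- s] ++ t); split.
  move=> x; rewrite mem_cat => /orP[/mapP[y ys ->]|/St//].
  by have [? ?] := Ss y ys; split=> //; apply: SZ.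
rewrite big_cat big_map scaler_sumr; congr (_ + _).
by apply: eq_bigr => x _; rewrite scalerAl.
Qed.

Lemma subspace_hilbert_ideal : subspace (hilbert_ideal H).
Proof. exact: subspace_ideal_in. Qed.

Lemma hilbert_idealM q p : hilbert_ideal H p -> hilbert_ideal H (q * p).
Proof.
move=> [s [Ss ->]]; exists [seq (q * x.1, x.2) | x <- s]; split.
  by move=> x /mapP[y ys ->]; have [_ ?] := Ss y ys.
by rewrite big_map mulr_sumr; apply: eq_bigr => x _; rewrite mulrA.
Qed.

Lemma hilbert_ideal_gen p : invariants_pos H p -> hilbert_ideal H p.
Proof.
move=> Hp; exists [:: (1, p)]; rewrite big_seq1 mul1r; split=> // x.
by rewrite inE => /eqP->.
Qed.

Lemma hilbert_ideal_act w p : H w -> hilbert_ideal H p ->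
  hilbert_ideal H (poly_act w p).
Proof.
move=> Hw [s [Ss ->]]; rewrite linear_sum /= big_seq.
apply: subspace_sum; first exact: subspace_hilbert_ideal.
move=> x /Ss[_ Hx]; rewrite rmorphM /=; apply: hilbert_idealM.
by rewrite Hx.1 //; apply: hilbert_ideal_gen.
Qed.

End HilbertIdeal.

(** * Averaging operators and a spanning set of the Hilbert ideal *)

Section Reynolds.
Variables (F : fieldType) (n : nat) (T : finType) (A : {set T}).
Variable (W : T -> 'M[F]_n).
Implicit Types p q : {mpoly F[n]}.

(** Averaging over an indexed family of matrices covers [G], the pairs in [G] x [G] and the diagonal
    group alike. *)
Definition reynolds p : {mpoly F[n]} :=
  #|A|%:R^-1 *: \sum_(t in A) poly_act (W t) p.

Lemma reynolds_is_linear : linear reynolds.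
Proof.
move=> a p q; rewrite /reynolds scalerA mulrC -scalerA -scalerDr.
congr (_ *: _); rewrite scaler_sumr -big_split; apply: eq_bigr => t _.
by rewrite /= linearP.
Qed.
HB.instance Definition _ :=
  GRing.isLinear.Build F {mpoly F[n]} {mpoly F[n]} _ reynolds reynolds_is_linear.

Lemma dhomog_reynolds d p : p \is d.-homog -> reynolds p \is d.-homog.
Proof.
move=> ph; apply: rpredZ; apply: rpred_sum => t _; exact: dhomog_poly_act.
Qed.

Variable H : set 'M[F]_n.
Hypotheses (HW : forall t, t \in A -> H (W t)) (A_neq0 : #|A|%:R != 0 :> F).

Lemma reynoldsM p q : invariants H q -> reynolds (p * q) = reynolds p * q.
Proof.
move=> Hq; rewrite /reynolds -scalerAl mulr_suml; congr (_ *: _).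
by apply: eq_bigr => t At; rewrite rmorphM /= (Hq _ (HW At)).
Qed.

Lemma reynolds_id p : invariants H p -> reynolds p = p.
Proof.
move=> Hp; rewrite /reynolds (eq_bigr (fun=> p)) => [|t At]; last first.
  exact/Hp/HW.
by rewrite sumr_const -scaler_nat scalerA mulVf // scale1r.
Qed.

(* So the Hilbert ideal lies in a span of homogeneous elements that are defined
   over any subfield containing the entries of the W t. *)
Lemma hilbert_ideal_ind (P : set {mpoly F[n]}) : subspace P ->
    (forall a m, m != 0%MM -> P ('X_[a] * reynolds 'X_[m])) ->
  forall p, hilbert_ideal H p -> P p.
Proof.
move=> sP PX _ [s [Ss ->]]; rewrite big_seq; apply: subspace_sum => // -[q p].
move=> /Ss[_ [/= Hp p0]].
(* An invariant is its own average, hence a combination of averages of monomials; its zero constant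
   term removes the trivial monomial. *)
rewrite -(reynolds_id Hp) [p]mpolyE linear_sum /= mulr_sumr.
apply: subspace_sum => // m _; rewrite linearZ_LR /= -scalerAr.
have [->|m0] := eqVneq m 0%MM; first by rewrite p0 scale0r; case: sP.
apply: subspaceZ => //; rewrite [q]mpolyE mulr_suml.
apply: subspace_sum => // a _; rewrite -scalerAl; apply: subspaceZ => //.
exact: PX.
Qed.

End Reynolds.

(** * Coinvariant algebras and base change *)

Section Coinvariants.
Variables (F : fieldType) (gT : finGroupType) (G : {group gT}) (n : nat).
Variables (r : mx_representation F G n).
Hypothesis G_neq0 : #|G|%:R != 0 :> F.
Implicit Types p q : {mpoly F[n]}.
Local Notation ideal := (hilbert_ideal (linear_group r)).
Local Notation rey := (reynolds G r).

Lemma linear_group_mem g : g \in G -> linear_group r (r g).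
Proof. by move=> Gg; exists g. Qed.

Lemma poly_act_repr1 p : poly_act (r 1%g) p = p.
Proof. by rewrite repr_mx1 poly_act1. Qed.

Lemma poly_act_reprM g h p : g \in G -> h \in G ->
  poly_act (r (g * h)%g) p = poly_act (r g) (poly_act (r h) p).
Proof.
move=> Gg Gh; rewrite (repr_mxM r Gg Gh) poly_actM; first reflexivity.
  exact: repr_mx_unit.
exact: repr_mx_unit.
Qed.

Lemma reynolds_invariant p : invariants (linear_group r) (rey p).
Proof.
move=> _ [g Gg <-]; rewrite /reynolds (linearZ_LR (poly_act _)) /=; congr (_ *: _).
rewrite (linear_sum (poly_act _)) /=.
rewrite [RHS](reindex_inj (mulgI g)) /=.
apply: eq_big => [h|h Gh]; first by rewrite groupMl.
by rewrite (poly_act_reprM _ Gg Gh).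
Qed.

Lemma hilbert_ideal_reynoldsX a m : m != 0%MM -> ideal ('X_[a] * rey 'X_[m]).
Proof.
move=> m0; apply/hilbert_idealM/hilbert_ideal_gen; split.
  exact: reynolds_invariant.
have mh : rey 'X_[m] \is (mdeg m).-homog.
  by apply: dhomog_reynolds; rewrite dhomogX.
by apply: (dhomog_nemf_coeff mh); rewrite /= mdeg0 eq_sym mdeg_eq0.
Qed.

Lemma hilbert_ideal_lin_ind (P : set {mpoly F[n]}) : subspace P ->
    (forall a m, m != 0%MM -> P ('X_[a] * rey 'X_[m])) ->
  forall p, ideal p -> P p.
Proof.
by move=> sP PX; apply: (hilbert_ideal_ind linear_group_mem G_neq0 sP PX).
Qed.

(** The ideal is spanned by homogeneous products, each of which the projection to degree [d] either
    fixes or kills. *)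
Lemma hilbert_ideal_pihomog d p : ideal p -> ideal (pihomog mdeg d p).
Proof.
have sI := subspace_hilbert_ideal (linear_group r).
move: p; apply: hilbert_ideal_lin_ind => [|a m m0].
  split=> [|c u v Iu Iv]; rewrite /mkset ?linear0; first by case: sI.
  by rewrite linearP; apply: sI.2.
have mh : 'X_[a] * rey 'X_[m] \is (mdeg a + mdeg m).-homog.
  by apply: dhomogM; [rewrite dhomogX | apply: dhomog_reynolds; rewrite dhomogX].
have [/eqP e|ne] := boolP (mdeg a + mdeg m == d)%N.
  by rewrite pihomog_dE -?e //; apply: hilbert_ideal_reynoldsX.
by rewrite (pihomog_ne0 ne mh); case: sI.
Qed.

Lemma exists_coinvariant_basis (i : nat) :
  exists d, has_quotient_dim (@homog_part F n i) ideal d.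
Proof.
pose N := #|{: 'X_{1..n < i.+1}}|.
(* The finite index type lists all monomials of degree at most [i]; those of smaller degree are
   replaced by 0 so that the family stays in degree [i]. *)
pose v (k : 'I_N) : {mpoly F[n]} :=
  let m := bmnm (enum_val k) in if mdeg m == i then 'X_[m] else 0.
apply: (@exists_quotient_basis _ _ _ _ N v).
- exact: subspace_homog.
- exact: subspace_hilbert_ideal.
- move=> k; rewrite /v /homog_part /mkset; case: ifP => [mi|_].
    by rewrite dhomogX.
  exact: rpred0.
move=> p ph; exists (\col_k p@_(bmnm (enum_val k))).
have sp : (msize p <= i.+1)%N.
  have [->|p0] := eqVneq p 0; first by rewrite msize0.
  by have := dhomog_uniq p0 ph (dhomog_msize ph) => ->; apply: leqSpred.
rewrite {1}(mpolywE sp) (reindex_onto (@enum_val _ _) enum_rank) /=; last first.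
  by move=> m _; rewrite enum_rankK.
apply: eq_big => [k|k _]; rewrite ?enum_valK ?eqxx // mxE /v.
case: ifP => // /negbT mi; rewrite scaler0.
by rewrite (dhomog_nemf_coeff ph mi) scale0r.
Qed.

Section Coordinates.
Variables (i d : nat) (b : 'I_d -> {mpoly F[n]}).
Hypothesis bP : quotient_basis (@homog_part F n i) ideal b.

(** Projecting to degree [i] first gives a linear map on all polynomials, so it can be evaluated on
    monomials of any degree; it kills the whole ideal because the ideal is homogeneous. *)
Definition coinv_coord p : 'cV[F]_d := quotient_coord ideal b (pihomog mdeg i p).

Lemma coinv_coord_is_linear : linear coinv_coord.
Proof.
move=> a p q; rewrite /coinv_coord linearP.
by rewrite (quotient_coordD (subspace_homog F n i) (subspace_hilbert_ideal _) bP) //;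
   apply: pihomogP.
Qed.

Lemma coinv_coordE p : p \is i.-homog -> coinv_coord p = quotient_coord ideal b p.
Proof. by move=> ph; rewrite /coinv_coord pihomog_dE. Qed.

Lemma coinv_coord_ideal p : ideal p -> coinv_coord p = 0.
Proof.
move=> Ip; apply: (quotient_coord0 bP); first exact: pihomogP.
exact: hilbert_ideal_pihomog.
Qed.

Lemma coinv_coord_basis k : coinv_coord (b k) = delta_mx k 0.
Proof.
rewrite coinv_coordE; last exact: bP.1.
exact: (quotient_coord_basis (subspace_hilbert_ideal _) bP).
Qed.

Definition coinv_repr : mx_representation F G d :=
  @quotient_repr F {mpoly F[n]} gT G (@homog_part F n i) ideal d b
    (fun g => poly_act (r g)) (subspace_homog F n i) (subspace_hilbert_ideal _) bP
    (fun g u _ => @dhomog_poly_act F n i (r g) u)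
    (fun g u Gg => hilbert_ideal_act (linear_group_mem Gg))
    poly_act_repr1 poly_act_reprM.

Lemma coinv_reprP g k : g \in G ->
  ideal (poly_act (r g) (b k) - \sum_l coinv_repr g l k *: b l).
Proof.
move=> Gg; apply: (quotient_mxP (T := fun g => poly_act (r g)) bP _ k Gg).
by move=> h u _; apply: dhomog_poly_act.
Qed.

Lemma coinvariant_charE g (M : 'M[F]_d) : g \in G ->
    (forall k, ideal (poly_act (r g) (b k) - \sum_l M l k *: b l)) ->
  coinvariant_char r i g = \tr M.
Proof.
move=> Gg MP; rewrite /coinvariant_char.
apply: (quotient_traceE (T := poly_act (r g)) _ _ _ _ bP MP).
- exact: subspace_homog.
- exact: subspace_hilbert_ideal.
- by move=> u; apply: dhomog_poly_act.
by move=> u; apply: hilbert_ideal_act; apply: linear_group_mem.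
Qed.

End Coordinates.

Lemma coinvariant_char_repr i :
  exists d (M : mx_representation F G d), forall g, g \in G ->
    coinvariant_char r i g = \tr (M g).
Proof.
have [d [b bP]] := exists_coinvariant_basis i.
exists d, (coinv_repr bP) => g Gg; apply: (coinvariant_charE bP Gg) => k.
exact: coinv_reprP.
Qed.

End Coinvariants.

(** * Coinvariant algebras under a field embedding *)

Section BaseChange.
Variables (K F : fieldType) (f : {rmorphism K -> F}).
Variables (gT : finGroupType) (G : {group gT}) (n : nat).
Variables (r : mx_representation K G n).
Hypothesis G_neq0 : #|G|%:R != 0 :> K.
Local Notation mapf := (map_mpoly f).
Local Notation idealK := (hilbert_ideal (linear_group r)).
Local Notation idealF := (hilbert_ideal (linear_group (map_repr f r))).

Lemma map_poly_act (w : 'M[K]_n) p :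
  mapf (poly_act w p) = poly_act (map_mx f w) (mapf p).
Proof.
rewrite /poly_act map_mpoly_comp; last exact: fmorph_inj.
congr (_ \mPo _); apply: eq_from_tnth => i; rewrite tnth_map !tnth_mktuple.
rewrite rmorph_sum; apply: eq_bigr => j _ /=.
by rewrite map_mpolyZ map_mpolyX -map_invmx mxE.
Qed.

Lemma map_hilbert_ideal p : idealK p -> idealF (mapf p).
Proof.
move=> [s [Ss ->]]; rewrite rmorph_sum big_seq.
apply: subspace_sum; first exact: subspace_hilbert_ideal.
move=> -[a q] /Ss[_ [/= Hq q0]]; rewrite rmorphM; apply/hilbert_idealM.
apply: hilbert_ideal_gen; split=> [_ [g Gg <-]|]; last first.
  rewrite mcoeff_map_mpoly q0; exact: (rmorph0 f).
by rewrite -map_poly_act Hq //; exists g.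
Qed.

Lemma map_reynolds p : mapf (reynolds G r p) = reynolds G (map_repr f r) (mapf p).
Proof.
rewrite /reynolds map_mpolyZ fmorphV rmorph_nat rmorph_sum; congr (_ *: _).
by apply: eq_bigr => g _; apply: map_poly_act.
Qed.

(** Generation passes to [F] because monomials are defined over [K]. Independence passes because the
    ideal over [F] is spanned by images of elements of the ideal over [K]. *)
Lemma quotient_basis_map i d (b : 'I_d -> {mpoly K[n]}) :
    quotient_basis (@homog_part K n i) idealK b ->
  quotient_basis (@homog_part F n i) idealF (fun k => mapf (b k)).
Proof.
move=> bP; have sI := subspace_hilbert_ideal (linear_group (map_repr f r)).
pose phi := coinv_coord r i b.
have map_lin p (c : 'cV[K]_d) :
    mapf (p - \sum_k c k 0 *: b k) = mapf p - \sum_k (map_mx f c) k 0 *: mapf (b k).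
  rewrite rmorphB rmorph_sum /=; congr (_ - _); apply: eq_bigr => k _.
  by rewrite map_mpolyZ mxE.
split=> [k|v vh].
  apply/dhomogP => m; rewrite mcoeff_msupp mcoeff_map_mpoly fmorph_eq0.
  by rewrite -mcoeff_msupp; apply/dhomogP/bP.1.
(* The projection to degree [i] makes the claim meaningful for every polynomial, so that it can be
   checked by linearity on monomials. *)
have [c Ic] : exists c : 'cV[F]_d,
    idealF (pihomog mdeg i v - \sum_k c k 0 *: mapf (b k)).
  move: v {vh}; apply: mpoly_lin_ind => [|m].
    split=> [|a u v [c Ic] [c' Ic']].
      exists 0; rewrite linear0 big1 ?subr0; first by case: sI.
      by move=> k _; rewrite mxE scale0r.
    exists (a *: c + c'); rewrite linearP /=; have := sI.2 a _ _ Ic Ic'.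
    congr (idealF _); rewrite scalerBr addrACA -opprD; congr (_ - _).
    rewrite scaler_sumr -big_split; apply: eq_bigr => k _ /=.
    by rewrite !mxE scalerDl scalerA.
  rewrite pihomogX; case: ifP => [/eqP mi|_]; last first.
    exists 0; rewrite big1 ?subr0; first by case: sI.
    by move=> k _; rewrite mxE scale0r.
  exists (map_mx f (phi 'X_[m])); rewrite -[X in X - _](map_mpolyX f).
  rewrite -map_lin; apply: map_hilbert_ideal.
  have Xh : ('X_[m] : {mpoly K[n]}) \is i.-homog by rewrite dhomogX /= mi.
  by rewrite /phi coinv_coordE //; apply: (quotient_coordP bP).
rewrite pihomog_dE // in Ic; exists c; split=> // c' Ic'.
(* The coordinate function over K, extended to F, still vanishes on the ideal. *)
pose psi := mpoly_lift (F := F) (fun m => map_mx f (phi 'X_[m])).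
have psiD a p q : psi (a *: p + q) = a *: psi p + psi q by rewrite /psi linearP.
have psi_map p : psi (mapf p) = map_mx f (phi p).
  move: p; apply: mpoly_lin_ind => [|m]; last first.
    by rewrite /mkset map_mpolyX /psi mpoly_liftX.
  have philin := coinv_coord_is_linear bP.
  split=> [|a p q Ep Eq]; rewrite /mkset.
    rewrite rmorph0 /psi linear0 /phi coinv_coord_ideal ?map_mx0 //.
    by case: (subspace_hilbert_ideal (linear_group r)).
  by rewrite rmorphD /= map_mpolyZ psiD Ep Eq /phi philin map_mxD map_mxZ.
have psi_ideal p : idealF p -> psi p = 0.
  have GF : #|G|%:R != 0 :> F by rewrite -(rmorph_nat f) fmorph_eq0.
  move: p; apply: (hilbert_ideal_lin_ind GF) => [|a m m0].
    split=> [|a p q Ep Eq]; rewrite /mkset ?psiD.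
      by rewrite /psi linear0.
    by rewrite Ep Eq scaler0 addr0.
  rewrite -!(map_mpolyX f) -map_reynolds -rmorphM psi_map /phi.
  by rewrite coinv_coord_ideal ?map_mx0 //; apply: hilbert_ideal_reynoldsX.
have psi_b k : psi (mapf (b k)) = delta_mx k 0.
  by rewrite psi_map /phi coinv_coord_basis // map_delta_mx.
have psiE (x : 'cV[F]_d) : idealF (v - \sum_k x k 0 *: mapf (b k)) -> psi v = x.
  move/psi_ideal; rewrite /psi linearB => /subr0_eq ->; rewrite linear_sum /=.
  under eq_bigr do rewrite linearZ_LR /= -[mpoly_lift _ _]/(psi _) psi_b.
  apply/matrixP => k j; rewrite ord1 summxE (bigD1 k) //= !mxE !eqxx mulr1.
  by rewrite big1 ?addr0 // => l lk; rewrite !mxE eq_sym (negPf lk) mulr0.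
by rewrite -(psiE c) // (psiE c').
Qed.

(** The image under [f] of a matrix of the action over [K] is a matrix of the action over [F]. With
    [f] equal to [iota \o sigma], this computes the characters of the coinvariant algebra of the
    conjugate group. *)
Lemma coinvariant_char_map i g : g \in G ->
  coinvariant_char (map_repr f r) i g = f (coinvariant_char r i g).
Proof.
move=> Gg; have [d [b bP]] := exists_coinvariant_basis r i.
rewrite (coinvariant_charE bP Gg (fun k => coinv_reprP bP k Gg)).
rewrite -trace_map_mx /=.
apply: (coinvariant_charE (quotient_basis_map bP) Gg) => k.
have := map_hilbert_ideal (coinv_reprP bP k Gg).
rewrite rmorphB /= map_poly_act; congr (idealF (_ - _)).
rewrite rmorph_sum.
apply: eq_bigr => l _; rewrite /= map_mpolyZ; congr (_ *: _).
by rewrite [RHS]mxE.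
Qed.

End BaseChange.

(** * Polynomials in two sets of variables *)

Section TwoSets.
Variables (F : fieldType) (n : nat).
Implicit Types (p q : {mpoly F[n]}) (w : 'M[F]_n) (m : 'X_{1..n + n}).

(** The two embeddings of one-set polynomials; [inX p * inY q] plays the role of the tensor of [p]
    and [q]. *)
Definition inX p : {mpoly F[n + n]} := p \mPo [tuple 'X_(lshift n i) | i < n].
Definition inY p : {mpoly F[n + n]} := p \mPo [tuple 'X_(rshift n i) | i < n].

HB.instance Definition _ :=
  GRing.LRMorphism.copy inX (comp_mpoly [tuple 'X_(lshift n i) | i < n]).
HB.instance Definition _ :=
  GRing.LRMorphism.copy inY (comp_mpoly [tuple 'X_(rshift n i) | i < n]).

Definition mnmX m : 'X_{1..n} := [multinom m (lshift n k) | k < n].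
Definition mnmY m : 'X_{1..n} := [multinom m (rshift n k) | k < n].
Definition mnm_join (a b : 'X_{1..n}) : 'X_{1..n + n} :=
  [multinom match split k with inl i => a i | inr j => b j end | k < n + n].

Lemma mnm_joinX a b : mnmX (mnm_join a b) = a.
Proof. by apply/mnmP => k; rewrite !mnmE (unsplitK (inl _ k)). Qed.

Lemma mnm_joinY a b : mnmY (mnm_join a b) = b.
Proof. by apply/mnmP => k; rewrite !mnmE (unsplitK (inr _ k)). Qed.

Lemma inXX (a : 'X_{1..n}) : inX 'X_[a] = \prod_(i < n) 'X_(lshift n i) ^+ a i.
Proof. by rewrite /inX comp_mpolyX; apply: eq_bigr => i _; rewrite tnth_mktuple. Qed.

Lemma inYX (a : 'X_{1..n}) : inY 'X_[a] = \prod_(i < n) 'X_(rshift n i) ^+ a i.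
Proof. by rewrite /inY comp_mpolyX; apply: eq_bigr => i _; rewrite tnth_mktuple. Qed.

Lemma mpolyX_split m : 'X_[m] = inX 'X_[mnmX m] * inY 'X_[mnmY m].
Proof.
rewrite inXX inYX mpolyXE_id big_split_ord.
by congr (_ * _); apply: eq_bigr => i _; rewrite mnmE.
Qed.

Lemma mpolyX_join (a b : 'X_{1..n}) : inX 'X_[a] * inY 'X_[b] = 'X_[mnm_join a b].
Proof. by rewrite mpolyX_split mnm_joinX mnm_joinY. Qed.

Lemma mnm_split_eq0 m : (m == 0%MM) = (mnmX m == 0%MM) && (mnmY m == 0%MM).
Proof.
apply/eqP/andP => [->|[/eqP mX /eqP mY]].
  by split; apply/eqP/mnmP => k; rewrite !mnmE.
apply/mnmP => k; rewrite -(splitK k) mnmE; case: (split k) => j /=.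
  by have := congr1 (fun a : 'X_{1..n} => a j) mX; rewrite /= !mnmE.
by have := congr1 (fun a : 'X_{1..n} => a j) mY; rewrite /= !mnmE.
Qed.

Lemma tensor_ind (P : {mpoly F[n]} -> {mpoly F[n]} -> Prop) :
    (forall q, subspace (P^~ q)) -> (forall p, subspace (P p)) ->
    (forall a b, P 'X_[a] 'X_[b]) ->
  forall p q, P p q.
Proof.
move=> sX sY PX p q; move: p; apply: mpoly_lin_ind => // a.
by move: q; apply: mpoly_lin_ind.
Qed.

Section Block.
Variables w w' : 'M[F]_n.
Hypotheses (Uw : w \in unitmx) (Uw' : w' \in unitmx).
Local Notation ww' := (block_mx w 0 0 w').

Lemma unitmx_block_diag : ww' \in unitmx.
Proof. by rewrite block_diag_mx_unit Uw. Qed.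

Lemma poly_act_inX p : poly_act ww' (inX p) = inX (poly_act w p).
Proof.
move: p; apply: mpoly_lin_ind => [|a]; rewrite /mkset.
  split=> [|c p q Ep Eq]; first by rewrite !linear0.
  rewrite !linearP /= Ep Eq; reflexivity.
rewrite poly_actX inXX !rmorph_prod; apply: eq_bigr => i _.
rewrite !rmorphXn; congr (_ ^+ _); rewrite /= poly_actXU linear_sum /=.
rewrite (invmx_block_diag unitmx_block_diag) big_split_ord /=.
rewrite [X in _ + X]big1 ?addr0; last first.
  by move=> j _; rewrite block_mxEur mxE scale0r.
apply: eq_bigr => j _; rewrite block_mxEul linearZ_LR /=; congr (_ *: _).
by rewrite /inX comp_mpolyXU -tnth_nth tnth_mktuple.
Qed.

Lemma poly_act_inY p : poly_act ww' (inY p) = inY (poly_act w' p).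
Proof.
move: p; apply: mpoly_lin_ind => [|a]; rewrite /mkset.
  split=> [|c p q Ep Eq]; first by rewrite !linear0.
  rewrite !linearP /= Ep Eq; reflexivity.
rewrite poly_actX inYX !rmorph_prod; apply: eq_bigr => i _.
rewrite !rmorphXn; congr (_ ^+ _); rewrite /= poly_actXU linear_sum /=.
rewrite (invmx_block_diag unitmx_block_diag) big_split_ord /=.
rewrite [X in X + _]big1 ?add0r; last first.
  by move=> j _; rewrite block_mxEdl mxE scale0r.
apply: eq_bigr => j _; rewrite block_mxEdr linearZ_LR /=; congr (_ *: _).
by rewrite /inY comp_mpolyXU -tnth_nth tnth_mktuple.
Qed.

Lemma poly_act_tensor p q :
  poly_act ww' (inX p * inY q) = inX (poly_act w p) * inY (poly_act w' q).
Proof. by rewrite rmorphM /= poly_act_inX poly_act_inY. Qed.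

End Block.

Lemma subspace_bihomog i j : subspace (@bihomog_part F n i j).
Proof.
split=> [m|a u v hu hv m]; first by rewrite msupp0.
move=> /msuppD_le; rewrite mem_cat => /orP[/msuppZ_le/hu|/hv] //.
Qed.

Lemma bihomogX i j m :
    mdeg (mnmX m) = i -> mdeg (mnmY m) = j ->
  bihomog_part i j ('X_[m] : {mpoly F[n + n]}).
Proof.
move=> <- <- m'; rewrite msuppX inE => /eqP->; rewrite !mdegE.
by split; apply: eq_bigr => k _; rewrite mnmE.
Qed.

Lemma bihomog_tensor i j p q : p \is i.-homog -> q \is j.-homog ->
  bihomog_part i j (inX p * inY q).
Proof.
move=> /dhomogP ph /dhomogP qh; have sS := subspace_bihomog i j.
rewrite [p]mpolyE [q]mpolyE (linear_sum inX) (linear_sum inY) /= mulr_suml big_seq.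
apply: subspace_sum => // a /ph /= ai; rewrite mulr_sumr big_seq.
apply: subspace_sum => // b /qh /= bj.
rewrite (linearZ_LR inX) (linearZ_LR inY) /=.
rewrite -scalerAl -scalerAr; do 2!apply: (subspaceZ _ sS).
by rewrite mpolyX_join; apply: bihomogX; rewrite ?mnm_joinX ?mnm_joinY.
Qed.

Lemma bihomog_msupp i j (v : {mpoly F[n + n]}) m : bihomog_part i j v ->
  m \in msupp v -> mdeg (mnmX m) = i /\ mdeg (mnmY m) = j.
Proof.
move=> vh /vh[<- <-]; rewrite !mdegE.
by split; apply: eq_bigr => k _; rewrite mnmE.
Qed.

Lemma bihomog_act i j w w' v : w \in unitmx -> w' \in unitmx ->
  bihomog_part i j v -> bihomog_part i j (poly_act (block_mx w 0 0 w') v).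
Proof.
move=> Uw Uw' vh; have sS := subspace_bihomog i j.
rewrite [v]mpolyE (linear_sum (poly_act _)) /= big_seq.
apply: subspace_sum => // m /(bihomog_msupp vh)[mi mj].
rewrite (linearZ_LR (poly_act _)) /=; apply: (subspaceZ _ sS).
rewrite mpolyX_split poly_act_tensor //.
by apply: bihomog_tensor; apply: dhomog_poly_act; rewrite dhomogX /= ?mi ?mj.
Qed.

End TwoSets.

(** * The diagonal invariants modulo the product invariants *)

Section TensorQuotient.
Variables (F : fieldType) (gT : finGroupType) (G : {group gT}) (n : nat).
Variables (r r' : mx_representation F G n).
Hypothesis G_neq0 : #|G|%:R != 0 :> F.
Local Notation idealX := (hilbert_ideal (linear_group r)).
Local Notation idealY := (hilbert_ideal (linear_group r')).
Local Notation ideal := (hilbert_ideal (prod_group r r')).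

Let block (gh : gT * gT) : 'M[F]_(n + n) := block_mx (r gh.1) 0 0 (r' gh.2).

Lemma prod_group_mem g h : g \in G -> h \in G ->
  prod_group r r' (block_mx (r g) 0 0 (r' h)).
Proof.
by move=> Gg Gh; exists (r g); [exists g | exists (r' h) => //; exists h].
Qed.

(** The two factors of the group act on separate variables, so the sum over pairs factors. *)
Lemma reynolds_tensor p q : reynolds (finset.setX G G) block (inX p * inY q) =
  inX (reynolds G r p) * inY (reynolds G r' q).
Proof.
rewrite /reynolds cardsX natrM invfM (linearZ_LR (@inX F n)) (linearZ_LR (@inY F n)).
rewrite (linear_sum (@inX F n)) (linear_sum (@inY F n)) /= -scalerAl -scalerAr scalerA.
congr (_ *: _); rewrite [RHS]big_distrlr pair_big_dep /=.
apply: eq_big => [[g h]|[g h]]; rewrite inE //=.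
by move=> /andP[Gg Gh]; rewrite poly_act_tensor ?repr_mx_unit.
Qed.

(** An invariant in the x variables alone is also fixed by the second factor, and the embedding
    creates no constant term. *)
Lemma hilbert_ideal_inX p : idealX p -> ideal (inX p).
Proof.
have sI := subspace_hilbert_ideal (prod_group r r').
move=> [s [Ss ->]]; rewrite (linear_sum (@inX F n)) big_seq.
apply: subspace_sum => // -[a q] /Ss[_ [/= Hq q0]].
rewrite rmorphM /=; apply/hilbert_idealM/hilbert_ideal_gen; split.
  move=> _ [_ [g Gg <-] [_ [h Gh <-] <-]].
  by rewrite poly_act_inX ?repr_mx_unit // Hq //; exists g.
rewrite [q]mpolyE (linear_sum (@inX F n)) raddf_sum /= big1 // => m _.
have [->|m0] := eqVneq m 0%MM; first by rewrite q0 scale0r linear0 mcoeff0.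
rewrite (linearZ_LR (@inX F n)) mcoeffZ /= -[inX _]mulr1 -(rmorph1 (@inY F n)).
rewrite -mpolyX0 mpolyX_join mcoeffX mnm_split_eq0 mnm_joinX mnm_joinY.
by rewrite (negPf m0) mulr0.
Qed.

Lemma hilbert_ideal_inY p : idealY p -> ideal (inY p).
Proof.
have sI := subspace_hilbert_ideal (prod_group r r').
move=> [s [Ss ->]]; rewrite (linear_sum (@inY F n)) big_seq.
apply: subspace_sum => // -[a q] /Ss[_ [/= Hq q0]].
rewrite rmorphM /=; apply/hilbert_idealM/hilbert_ideal_gen; split.
  move=> _ [_ [g Gg <-] [_ [h Gh <-] <-]].
  by rewrite poly_act_inY ?repr_mx_unit // Hq //; exists h.
rewrite [q]mpolyE (linear_sum (@inY F n)) raddf_sum /= big1 // => m _.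
have [->|m0] := eqVneq m 0%MM; first by rewrite q0 scale0r linear0 mcoeff0.
rewrite (linearZ_LR (@inY F n)) mcoeffZ /= -[inY _]mul1r -(rmorph1 (@inX F n)).
rewrite -mpolyX0 mpolyX_join mcoeffX mnm_split_eq0 mnm_joinX mnm_joinY.
by rewrite (negPf m0) andbF mulr0.
Qed.

(** * Tensor products of coinvariant bases *)

Section Bases.
Variables (i j d d' : nat).
Variables (b : 'I_d -> {mpoly F[n]}) (b' : 'I_d' -> {mpoly F[n]}).
Hypothesis bP : quotient_basis (@homog_part F n i) idealX b.
Hypothesis bP' : quotient_basis (@homog_part F n j) idealY b'.
Local Notation D := #|{: 'I_d * 'I_d'}|.

Definition tensor_basis (s : 'I_D) : {mpoly F[n + n]} :=
  inX (b (enum_val s).1) * inY (b' (enum_val s).2).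

Definition tensor_col (c : 'cV[F]_d) (c' : 'cV[F]_d') : 'cV[F]_D :=
  \col_s (c (enum_val s).1 0 * c' (enum_val s).2 0).

Lemma tensor_coord_ideal p q : p \is i.-homog -> q \is j.-homog ->
  ideal (inX p * inY q - \sum_s
    tensor_col (quotient_coord idealX b p) (quotient_coord idealY b' q) s 0 *:
      tensor_basis s).
Proof.
move=> ph qh; have sI := subspace_hilbert_ideal (prod_group r r').
set c := quotient_coord _ _ p; set c' := quotient_coord _ _ q.
pose B := \sum_k c k 0 *: b k; pose B' := \sum_k c' k 0 *: b' k.
have -> : \sum_s tensor_col c c' s 0 *: tensor_basis s = inX B * inY B'.
  rewrite (linear_sum (@inX F n)) (linear_sum (@inY F n)) /=.
  rewrite [RHS]big_distrlr pair_bigA.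
  rewrite (reindex_onto (@enum_rank _) enum_val) /=; last first.
    by move=> s _; rewrite enum_valK.
  apply: eq_big => [[k l]|[k l] _]; first by rewrite enum_rankK eqxx.
  rewrite mxE /tensor_basis !enum_rankK.
  rewrite (linearZ_LR (@inX F n)) (linearZ_LR (@inY F n)) /=.
  by rewrite -scalerAl -scalerAr scalerA.
(* This identity writes a difference of tensors as multiples of [inX (p - B)] and [inY (q - B')],
   both in the ideal. *)
have mulB (A : comPzRingType) (x y z t : A) :
    x * y - z * t = y * (x - z) + z * (y - t).
  by rewrite !mulrBr addrA ![y * _]mulrC subrK.
rewrite mulB -(rmorphB (@inX F n)) -(rmorphB (@inY F n)).
apply: (subspaceD sI); apply: hilbert_idealM.
  exact/hilbert_ideal_inX/(quotient_coordP bP).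
exact/hilbert_ideal_inY/(quotient_coordP bP').
Qed.

(** Monomials are tensors, which gives generation. Uniqueness comes from a map [Phi] that kills the
    ideal and sends the tensor basis to the matrix units. *)
Lemma tensor_quotient_basis :
  quotient_basis (@bihomog_part F n i j) ideal tensor_basis.
Proof.
have sI := subspace_hilbert_ideal (prod_group r r').
have sS := @subspace_bihomog F n i j.
pose phi := coinv_coord r i b; pose phi' := coinv_coord r' j b'.
have phiD a u v : phi (a *: u + v) = a *: phi u + phi v.
  exact: coinv_coord_is_linear bP a u v.
have phiD' a u v : phi' (a *: u + v) = a *: phi' u + phi' v.
  exact: coinv_coord_is_linear bP' a u v.
have phi0 : phi 0 = 0.
  rewrite /phi coinv_coord_ideal //.
  by case: (subspace_hilbert_ideal (linear_group r)).
have phi0' : phi' 0 = 0.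
  rewrite /phi' coinv_coord_ideal //.
  by case: (subspace_hilbert_ideal (linear_group r')).
(* [Phi] is the tensor product of the two coordinate maps, with outer products of coordinate vectors
   as values. *)
pose Phi := mpoly_lift (F := F) (fun m : 'X_{1..n + n} =>
  phi 'X_[mnmX m] *m (phi' 'X_[mnmY m])^T).
have PhiD a u v : Phi (a *: u + v) = a *: Phi u + Phi v by rewrite /Phi linearP.
have Phi0 : Phi 0 = 0 by rewrite /Phi linear0.
have Phi_tensor p q : Phi (inX p * inY q) = phi p *m (phi' q)^T.
  move: p q; apply: tensor_ind => [q|p|x y].
  - split=> [|a u v Eu Ev].
      by rewrite /mkset linear0 mul0r Phi0 phi0 mul0mx.
    rewrite /mkset linearP /= mulrDl -scalerAl PhiD Eu Ev phiD.
    by rewrite mulmxDl scalemxAl.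
  - split=> [|a u v Eu Ev].
      by rewrite /mkset linear0 mulr0 Phi0 phi0' trmx0 mulmx0.
    rewrite /mkset linearP /= mulrDr -scalerAr PhiD Eu Ev phiD'.
    by rewrite linearP /= mulmxDr scalemxAr.
  by rewrite mpolyX_join /Phi mpoly_liftX mnm_joinX mnm_joinY.
have Phi_ideal p : ideal p -> Phi p = 0.
  move: p; apply: (@hilbert_ideal_ind _ _ _ (finset.setX G G) block).
  - by move=> [g h]; rewrite inE => /andP[Gg Gh]; apply: prod_group_mem.
  - by rewrite cardsX natrM mulf_neq0.
  - split=> [//|a u v Eu Ev]; by rewrite /mkset PhiD Eu Ev scaler0 addr0.
  move=> a m m0; rewrite (mpolyX_split F a) (mpolyX_split F m) reynolds_tensor.
  rewrite mulrACA -(rmorphM (@inX F n)) -(rmorphM (@inY F n)) Phi_tensor /phi /phi'.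
  (* A nontrivial monomial has a nontrivial x part or y part, and the average of that part puts the
     corresponding factor in [idealX] or [idealY]. *)
  move: m0; rewrite mnm_split_eq0 negb_and => /orP[mX|mY].
    by rewrite coinv_coord_ideal ?mul0mx //; apply: hilbert_ideal_reynoldsX.
  rewrite [X in _ *m X^T]coinv_coord_ideal ?trmx0 ?mulmx0 //.
  exact: hilbert_ideal_reynoldsX.
split=> [s|v vh].
  by apply: bihomog_tensor; [apply: bP.1 | apply: bP'.1].
have [c Ic] : exists c : 'cV[F]_D, ideal (v - \sum_s c s 0 *: tensor_basis s).
  rewrite [v]mpolyE big_seq.
  apply: (big_ind (fun v => exists c : 'cV[F]_D,
    ideal (v - \sum_s c s 0 *: tensor_basis s))).
  - exists 0; rewrite big1 ?subr0; first by case: sI.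
    by move=> s _; rewrite mxE scale0r.
  - move=> u1 u2 [c1 Ic1] [c2 Ic2]; exists (c1 + c2).
    have := subspaceD sI Ic1 Ic2; congr (ideal _).
    rewrite addrACA -opprD; congr (_ - _); rewrite -big_split.
    by apply: eq_bigr => s _ /=; rewrite mxE scalerDl.
  move=> m /(bihomog_msupp vh)[mi mj].
  have := @tensor_coord_ideal 'X_[mnmX m] 'X_[mnmY m].
  rewrite !dhomogX /= mi mj => /(_ (eqxx _) (eqxx _)).
  rewrite -mpolyX_split; set c := tensor_col _ _ => /(subspaceZ v@_m sI) Ic.
  exists (v@_m *: c); move: Ic; congr (ideal _); rewrite scalerBr; congr (_ - _).
  rewrite scaler_sumr; apply: eq_bigr => s _; rewrite scalerA; congr (_ *: _).
  by rewrite [RHS]mxE.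
exists c; split=> // c' Ic'.
have Phi_basis s :
    Phi (tensor_basis s) = delta_mx (enum_val s).1 (enum_val s).2.
  rewrite Phi_tensor /phi (coinv_coord_basis bP) /phi' (coinv_coord_basis bP').
  by rewrite trmx_delta mul_delta_mx.
have PhiE (x : 'cV[F]_D) : ideal (v - \sum_s x s 0 *: tensor_basis s) ->
    forall s, Phi v (enum_val s).1 (enum_val s).2 = x s 0.
  move/Phi_ideal; rewrite /Phi linearB => /subr0_eq -> s; rewrite linear_sum /=.
  under eq_bigr do rewrite linearZ_LR /= -[mpoly_lift _ _]/(Phi _) Phi_basis.
  rewrite summxE (bigD1 s) //= !mxE !eqxx mulr1 big1 ?addr0 // => t ts.
  rewrite !mxE; case: andP => [[/eqP e1 /eqP e2]|]; last by rewrite mulr0.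
  case/eqP: ts; apply: enum_val_inj; apply/esym.
  by case: (enum_val s) (enum_val t) e1 e2 => ? ? [? ?] /= -> ->.
by apply/matrixP => s z; rewrite ord1 -(PhiE c) // (PhiE c').
Qed.

End Bases.

(** The dimension formula for invariants is applied to the diagonal action on the tensor basis,
    whose trace is the product of the two coinvariant characters; then the ideal is replaced by
    [diag_ideal]. *)
Lemma diag_hilbert_series i j : exists2 e,
  has_quotient_dim (invariants (diag_group r r') `&` @bihomog_part F n i j)
    (diag_ideal r r') e
  & #|G|%:R^-1 * \sum_(g in G) coinvariant_char r i g * coinvariant_char r' j g
    = e%:R.
Proof.
have sS := @subspace_bihomog F n i j.
have sI := subspace_hilbert_ideal (prod_group r r').
have [d [b bP]] := exists_coinvariant_basis r i.
have [d' [b' bP']] := exists_coinvariant_basis r' j.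
have tP := tensor_quotient_basis bP bP'.
pose T g : {linear {mpoly F[n + n]} -> {mpoly F[n + n]}} :=
  poly_act (block_mx (r g) 0 0 (r' g)).
have TS g u : g \in G -> bihomog_part i j u -> bihomog_part i j (T g u).
  by move=> Gg; apply: bihomog_act; rewrite repr_mx_unit.
have TI g u : g \in G -> ideal u -> ideal (T g u).
  by move=> Gg; apply: hilbert_ideal_act; apply: prod_group_mem.
have T1 u : T 1%g u = u.
  by rewrite /T /= !repr_mx1 -scalar_mx_block poly_act1.
have TM g h u : g \in G -> h \in G -> T (g * h)%g u = T g (T h u).
  move=> Gg Gh; rewrite /T /=.
  have -> : block_mx (r (g * h)%g) 0 0 (r' (g * h)%g) =
      block_mx (r g) 0 0 (r' g) *m block_mx (r h) 0 0 (r' h).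
    by rewrite mulmx_block !mulmx0 !mul0mx !addr0 !add0r !repr_mxM.
  by apply/esym/poly_actM; rewrite unitmx_block_diag ?repr_mx_unit.
have [e eP eE] := quotient_invariants_dim sS sI tP TS TI T1 TM G_neq0.
have invE v : invariants (diag_group r r') v <-> forall g, g \in G -> T g v = v.
  split=> [vG g Gg|vG _ [g Gg <-]]; last exact: vG.
  by apply: vG; exists g.
exists e; last first.
  rewrite -eE; congr (_ * _); apply: eq_bigr => g Gg.
  rewrite (coinvariant_charE bP Gg (fun k => coinv_reprP bP k Gg)).
  rewrite (coinvariant_charE bP' Gg (fun k => coinv_reprP bP' k Gg)).
  rewrite /mxtrace mulr_suml; under eq_bigr do rewrite mulr_sumr.
  rewrite pair_bigA [RHS](reindex_onto (@enum_rank _) enum_val) /=; last first.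
    by move=> s _; rewrite enum_valK.
  apply: eq_big => [[k l]|[k l] _]; first by rewrite enum_rankK eqxx.
  rewrite !mxE /tensor_basis enum_rankK /= /T /= poly_act_tensor ?repr_mx_unit //.
  have kh : poly_act (r g) (b k) \is i.-homog by apply/dhomog_poly_act/bP.1.
  have lh : poly_act (r' g) (b' l) \is j.-homog by apply/dhomog_poly_act/bP'.1.
  rewrite (quotient_coordE tP (bihomog_tensor kh lh) (tensor_coord_ideal bP bP' kh lh)).
  by rewrite mxE enum_rankK.
rewrite setIC.
have -> : invariants (diag_group r r') = [set v | forall g, g \in G -> T g v = v].
  by apply/seteqP; split=> v /invE.
apply: has_quotient_dim_eq eP.
  apply: subspaceI => //; split=> [g Gg|a u v uG vG g Gg]; first by rewrite linear0.
  by rewrite linearP uG // vG.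
have HW g : g \in G -> diag_group r r' (block_mx (r g) 0 0 (r' g)).
  by move=> Gg; exists g.
have sub p : invariants (prod_group r r') p -> invariants (diag_group r r') p.
  by move=> Hp _ [g Gg <-]; apply/Hp/prod_group_mem.
apply/seteqP; split=> v [Sv Iv]; (split; first exact: Sv); last first.
  have [s [Ss ->]] := Iv; exists s; split=> [x /Ss[_ Hx]|]; last reflexivity.
  by split.
have vG : invariants (diag_group r r') v by apply/invE; case: Sv.
(* A diagonal invariant equals its diagonal average, and averaging commutes with multiplication by
   product invariants. Only the coefficients are averaged, and they become diagonal invariants. *)
rewrite -(reynolds_id HW G_neq0 vG); have [s [Ss ->]] := Iv.
exists [seq (reynolds G (fun g => block_mx (r g) 0 0 (r' g)) x.1, x.2) | x <- s].
split=> [_ /mapP[x /Ss[_ Hx] ->]|].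
  split; last exact: Hx.
  move=> _ [g Gg <-].
  rewrite /reynolds (linearZ_LR (poly_act _)) /= (linear_sum (poly_act _)) /=.
  congr (_ *: _); rewrite [RHS](reindex_inj (mulgI g)) /=.
  apply: eq_big => [h|h Gh]; first by rewrite groupMl.
  exact/esym/TM.
rewrite (linear_sum (reynolds _ _)) /= big_map big_seq [RHS]big_seq.
apply: eq_bigr => x /Ss[_ [/sub Hx _]].
exact: (reynoldsM HW).
Qed.

End TensorQuotient.

(** * Fake degrees *)

Section FakeDegreeSum.
Variables (C : numClosedFieldType) (gT : finGroupType) (G : {group gT}).
Variables (K : splittingFieldType rat) (iota : {rmorphism K -> C}).
Variable sigma : gal_of {:K}.
Variable rho : forall l : irr_index C G, mx_representation K G (irr_degree l).
Hypothesis rhoP : forall l, mx_rsim (extend_repr iota (rho l)) (irr_repr l).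

(** The inner products with [N] are multiplicities, natural numbers fixed by [sigma], so summing
    them against the conjugated irreducible characters rebuilds the conjugate of [b]. *)
Lemma char_inner_gal_sum (a b : gT -> K) d e
    (M : mx_representation C G d) (N : mx_representation C G e) :
    (forall g, g \in G -> \tr (M g) = iota (a g)) ->
    (forall g, g \in G -> \tr (N g) = iota (b g)) ->
  \sum_l char_inner G (mxchar (gal_repr_extend iota sigma (rho l))) (mxchar M) *
          char_inner G (mxchar (conj_repr (irr_repr l))) (mxchar N) =
  #|G|%:R^-1 * \sum_(g in G) iota (a g) * iota (sigma (b g)).
Proof.
move=> Ma Nb; have G_neq0 := natr_cardG_neq0 G C.
pose chi l g : K := \tr (rho l g).
have chiE l g : g \in G -> \tr (irr_repr l g) = iota (chi l g).
  by move=> Gg; rewrite -(mxtrace_rsim (rhoP l)) // trace_map_mx.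
have conj_tr k (r : mx_representation C G k) g :
    g \in G -> \tr (conj_repr r g) = \tr (r g^-1%g).
  by move=> Gg; rewrite -conj_mxtrace_repr //; apply: trace_map_mx.
(* Pairing [conj_repr (irr_repr l)] with [N] counts [irr_repr l] in the conjugate of [N], so it is
   the conjugate that is decomposed. *)
have [m mP] := char_irr_sum (conj_repr N).
have conjE g : g \in G -> (\tr (N g))^* = \sum_l (m l)%:R * \tr (irr_repr l g).
  by move=> Gg; rewrite -mP // -trace_map_mx.
have multE l : char_inner G (mxchar (conj_repr (irr_repr l))) (mxchar N) = (m l)%:R.
  rewrite /char_inner; apply: (canLR (mulKf G_neq0)).
  transitivity (\sum_k (m k)%:R *
      \sum_(g in G) \tr (irr_repr l g^-1%g) * \tr (irr_repr k g)).
    under [RHS]eq_bigr do rewrite mulr_sumr.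
    rewrite exchange_big; apply: eq_bigr => g Gg /=.
    rewrite /mxchar conjE // mulr_sumr; apply: eq_bigr => k _.
    by rewrite mulrCA conj_tr.
  rewrite (bigD1 l) //= irr_char_orthogonality eqxx mulr1 big1 ?addr0 1?mulrC //.
  by move=> k kl; rewrite irr_char_orthogonality eq_sym (negPf kl) !mulr0.
(* Injectivity of [iota] brings the decomposition down to [K], where [sigma] can be applied to
   it. *)
have bE g : g \in G -> b g^-1%g = \sum_l (m l)%:R * chi l g.
  move=> Gg; apply: (fmorph_inj iota).
  rewrite -Nb ?groupV // -conj_mxtrace_repr // conjE // rmorph_sum.
  by apply: eq_bigr => l _; rewrite rmorphM rmorph_nat chiE.
under eq_bigr do rewrite multE /char_inner -mulrA mulr_suml.
(* Replacing [g] by its inverse on the right matches the complex conjugates on the left, both in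
   [bE] and in the character of [M]. *)
rewrite -mulr_sumr exchange_big [in RHS](reindex_inj invg_inj) /=; congr (_ * _).
apply: eq_big => g; rewrite ?groupV // => Gg.
have -> : iota (sigma (b g^-1%g)) = \sum_l (m l)%:R * iota (sigma (chi l g)).
  rewrite bE // !rmorph_sum; apply: eq_bigr => l _.
  by rewrite !rmorphM !rmorph_nat.
rewrite -Ma ?groupV // -conj_mxtrace_repr // mulr_sumr.
apply: eq_bigr => l _; rewrite /mxchar [\tr (gal_repr_extend _ _ _ _)]trace_map_mx.
by rewrite [LHS]mulrC [RHS]mulrCA [X in _ * X]mulrC.
Qed.

(** The graded pieces of the coinvariant algebra supply [M] and [N]; base change along [iota] shows
    that their characters take values in the image of [K]. *)
Lemma bimahonian_average n (rW : mx_representation K G n) i j :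
  bimahonian iota sigma rW rho i j =
  #|G|%:R^-1 * \sum_(g in G) coinvariant_char (extend_repr iota rW) i g *
                             coinvariant_char (gal_repr_extend iota sigma rW) j g.
Proof.
have G_neq0 : #|G|%:R != 0 :> K.
  by rewrite -(fmorph_eq0 iota) rmorph_nat natr_cardG_neq0.
have [d [M MP]] := coinvariant_char_repr (extend_repr iota rW) i.
have [e [N NP]] := coinvariant_char_repr (extend_repr iota rW) j.
have mapE k g : g \in G ->
    coinvariant_char (extend_repr iota rW) k g = iota (coinvariant_char rW k g).
  exact: coinvariant_char_map.
have Ma g : g \in G -> \tr (M g) = iota (coinvariant_char rW i g).
  by move=> Gg; rewrite -(MP g Gg) (mapE i g Gg).
have Nb g : g \in G -> \tr (N g) = iota (coinvariant_char rW j g).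
  by move=> Gg; rewrite -(NP g Gg) (mapE j g Gg).
transitivity (\sum_l
    char_inner G (mxchar (gal_repr_extend iota sigma (rho l))) (mxchar M) *
    char_inner G (mxchar (conj_repr (irr_repr l))) (mxchar N)).
  apply: eq_bigr => l _; rewrite /fake_degree /char_inner.
  by congr (_ * _ * (_ * _)); apply: eq_bigr => g Gg; rewrite ?(MP g Gg) ?(NP g Gg).
rewrite (char_inner_gal_sum Ma Nb); congr (_ * _); apply: eq_bigr => g Gg.
by rewrite (mapE i g Gg) (coinvariant_char_map _ _ G_neq0 j Gg).
Qed.

End FakeDegreeSum.

Theorem theorem1p2 (R : realType) (gT : finGroupType) (G : {group gT}) (n : nat)
    (K : splittingFieldType rat) (zeta : K) (iota : {rmorphism K -> R[i]})
    (zeta_prim : (exponent G).-primitive_root zeta)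
    (K_gen : (<<1; zeta>> = {:K})%VS)
    (sigma : gal_of {:K}) (sigma_gal : (sigma \in 'Gal({:K} / 1))%g)
    (rW : mx_representation K G n)
    (W_refl : reflection_group (extend_repr iota rW))
    (rho : forall l : irr_index R[i] G, mx_representation K G (irr_degree l))
    (rho_real : forall l, mx_rsim (extend_repr iota (rho l)) (irr_repr l)) :
  is_diag_hilbert_series (extend_repr iota rW) (gal_repr_extend iota sigma rW)
    (bimahonian iota sigma rW rho).
Proof.
move=> i j; rewrite (bimahonian_average sigma rho_real).
exact/diag_hilbert_series/natr_cardG_neq0.
Qed.
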